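(* Let $(c_k)_{k\ge 1}$ be a sequence of real numbers with $c_k\ge 0$ and $0<\sum_{k\ge1}c_k<\infty$, and let $w(e^{it})=4\sum_{k\ge 1}c_k\sin^2(kt/2)$ be the corresponding LKS weight on $\mathbb{T}$. For a complex sequence $\lambda=(\lambda_k)_{k\in\mathbb{Z}}$ put $$\mu_k^2=\mu_k^2(\lambda):=\sum_{j\in\mathbb{Z}}c_{|k-j|}\,|\lambda_j-\lambda_k|^2 ,\qquad k\in\mathbb{Z}$$ (with $c_0=0$). Then $\lambda\in \mathrm{Mult}(L^2(w))$ if and only if $\lambda\in l^\infty(\mathbb{Z})$ and there is a constant $C$ such that $$\sum_{k\in\mathbb{Z}}|\hat f(k)|^2\mu_k^2\le C^2\|f\|^2_{L^2(w)}\qquad\text{for all } f\in\mathcal{P}.$$ Moreover, the following alternative holds: (1) either $1/w\in L^1(\mathbb{T})$, and then $\mathcal{S}_0\subset \mathrm{Mult}(L^2(w))$; (2) or $1/w\notin L^1(\mathbb{T})$, and then $\mathrm{Mult}(L^2(w))$ consists of all sequences $\lambda=(\lambda_n)_{n\in\mathbb{Z}}$ which are constant on each of the cosets $E_k=k+D\mathbb{Z}$, $k=0,\dots,D-1$, where $D=\mathrm{GCD}\{k\ge1:\ c_k>0\}$; in particular $\dim \mathrm{Mult}(L^2(w))=D<\infty$.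
   Context: $\mathbb{T}$ is the unit circle, $m$ is normalized Lebesgue measure on $\mathbb{T}$. $\mathcal{P}$ is the set of trigonometric polynomials, $\hat f(k)$ are Fourier coefficients, $\mathcal{S}_0$ is the space of finitely supported complex sequences on $\mathbb{Z}$. $L^2(w)=L^2(\mathbb{T},w\,dm)$ with $\|f\|^2_{L^2(w)}=\int_{\mathbb{T}}|f|^2w\,dm$. $\mathrm{Mult}(L^2(w))$ is the set of complex sequences $\lambda=(\lambda_n)_{n\in\mathbb{Z}}$ for which the linear map $e^{inx}\mapsto\lambda_ne^{inx}$ $(n\in\mathbb{Z})$ extends to a bounded linear operator $T_\lambda$ on $L^2(w)$. *)

(* Defs.v *)
From HB Require Import structures.
From mathcomp Require Import all_boot all_order all_algebra.
From mathcomp Require Import all_classical all_reals all_analysis.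
From mathcomp Require Import complex.

Set Implicit Arguments.
Unset Strict Implicit.
Unset Printing Implicit Defensive.

Import Order.TTheory GRing.Theory Num.Theory.
Import numFieldNormedType.Exports.

Local Open Scope classical_set_scope.
Local Open Scope ring_scope.
Local Open Scope complex_scope.

(* The unit circle is parametrized by t |-> e^{it}, 0 <= t <= 2 pi:
   a function F on the circle is represented by f : R -> R[i] with
   f t = F(e^{it}), only the values on [0, 2 pi] being relevant, and the
   normalized Lebesgue measure of the circle is dt / (2 pi). *)

Section Circle.
Variable R : realType.
Implicit Types (f g : R -> R[i]) (w : R -> R) (lam : int -> R[i]) (c : nat -> R).

Definition circle_dom : set R := `[0, 2 * pi].

Definition cabs (z : R[i]) : R := Normc.normc z.

Definition circle_int (g : R -> R) : \bar R :=
  (((2 * pi)^-1)%:E * \int[lebesgue_measure]_(t in circle_dom) (g t)%:E)%E.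

Definition L1 (g : R -> R) : Prop :=
  lebesgue_measure.-integrable circle_dom (fun t => (g t)%:E).

Definition cexp (n : int) : R -> R[i] :=
  fun t => cos (n%:~R * t) +i* sin (n%:~R * t).

Definition trigpoly : set (R -> R[i]) :=
  [set f | exists (s : seq int) (a : int -> R[i]),
     forall t, f t = \sum_(n <- s) a n * cexp n t].

Definition fourier f (n : int) : R[i] :=
  ((2 * pi)^-1)%:C *
  (Rintegral lebesgue_measure circle_dom (fun t => complex.Re (f t * cexp (- n) t))
   +i* Rintegral lebesgue_measure circle_dom (fun t => complex.Im (f t * cexp (- n) t))).

Definition normsq w f : \bar R :=
  circle_int (fun t => cabs (f t) ^+ 2 * w t).

(* Representatives of the elements of L^2(w). *)
Definition L2 w : set (R -> R[i]) :=
  [set f | [/\ measurable_fun circle_dom (fun t => complex.Re (f t)),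
               measurable_fun circle_dom (fun t => complex.Im (f t)) &
               (normsq w f < +oo)%E]].

(* Equality of classes in L^2(w). *)
Definition eqL2 w f g : Prop := normsq w (fun t => f t - g t) = 0%E.

(* A bounded operator on L^2(w), acting on representatives.  It is compatible
   with eqL2: if eqL2 w f g, then T (f - g) is null by boundedness, and
   T f = T (f - g) + T g in L^2(w) by linearity. *)
Definition bounded_op w (T : (R -> R[i]) -> (R -> R[i])) : Prop :=
  [/\ forall f, L2 w f -> L2 w (T f),
      forall (a : R[i]) f g, L2 w f -> L2 w g ->
        eqL2 w (T (fun t => a * f t + g t)) (fun t => a * T f t + T g t) &
      exists M : R, forall f, L2 w f ->
        (normsq w (T f) <= (M ^+ 2)%:E * normsq w f)%E].

Definition Mult w : set (int -> R[i]) :=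
  [set lam | exists2 T, bounded_op w T &
     forall n : int, eqL2 w (T (cexp n)) (fun t => lam n * cexp n t)].

Definition linfty : set (int -> R[i]) :=
  [set lam | exists M : R, forall n, cabs (lam n) <= M].

Definition finsupp_seq : set (int -> R[i]) :=
  [set lam | finite_set [set n | lam n != 0]].

(* If some c k is positive, the zeros of the weight in [0, 2 pi] are finitely many,
   so the convention 0^-1 = 0 does not affect integrability of its inverse. *)
Definition LKS_weight c : R -> R :=
  fun t => 4 * limn (fun n : nat =>
    \sum_(1 <= k < n) c k * sin (k%:R * t / 2) ^+ 2).

(* The sum is a priori in [0, +oo]. *)
Definition musq c lam (k : int) : \bar R :=
  \esum_(j in [set: int]) (c `|k - j|%N * cabs (lam j - lam k) ^+ 2)%:E.

(* S is a complex vector subspace of the space of two-sided sequences, with a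
   basis of n elements. *)
Definition cdim (S : set (int -> R[i])) (n : nat) : Prop :=
  exists b : 'I_n -> int -> R[i],
    (forall a : 'I_n -> R[i],
       (forall k, \sum_(i < n) a i * b i k = 0) -> forall i, a i = 0) /\
    S = [set lam | exists a : 'I_n -> R[i],
           forall k, lam k = \sum_(i < n) a i * b i k].

End Circle.

Definition is_gcd_set (A : set nat) (d : nat) : Prop :=
  (forall k, A k -> (d %| k)%N) /\
  (forall e, (forall k, A k -> (e %| k)%N) -> (e %| d)%N).

Definition gcd_set (A : set nat) : nat := xget 0%N [set d | is_gcd_set A d].

Lemma gcd_setP (A : set nat) : is_gcd_set A (gcd_set A).
Proof.
rewrite /gcd_set.
have [d Hd] : exists d, is_gcd_set A d; last exact: (xgetPex 0%N (ex_intro _ d Hd)).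
have [[a Aa a0]|nA] := pselect (exists2 a, A a & (0 < a)%N); last first.
  exists 0%N; split=> // k Ak; case: k Ak => // k Ak.
  by case: nA; exists k.+1.
pose P d := `[< (0 < d)%N /\
  forall e, (forall k, A k -> (e %| k)%N) -> (e %| d)%N >].
have exP : exists d, P d by exists a; apply/asboolP; split=> // e; apply.
case: (ex_minnP exP) => d /asboolP[d0 Hd] dmin; exists d; split=> // k Ak.
suff /dmin dle : P (gcdn d k).
  have/gcdn_idPl : gcdn d k = d; last by [].
  by apply/eqP; rewrite eqn_leq dle dvdn_leq ?dvdn_gcdl.
apply/asboolP; split; first by rewrite gcdn_gt0 d0.
by move=> e He; rewrite dvdn_gcd Hd // He.
Qed.

Definition int_coset (D k : nat) : set int :=
  [set n | exists q : int, n = k%:Z + D%:Z * q].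

(* Main.v *)
(* For a trigonometric polynomial f with coefficients a_n, Parseval's identity turns
   ||f||^2_{L^2(w)} into the Dirichlet form sum_{k >= 1} c_k sum_n |a_{n-k} - a_n|^2.
   Expanding lam_m a_m - lam_n a_n = lam_m (a_m - a_n) + a_n (lam_m - lam_n) gives the
   criterion at the level of trigonometric polynomials.  An operator bounded there extends
   to L^2(w): a function is first replaced by nearly orthogonal projections onto the
   trigonometric polynomials, so that no density result is needed, only completeness.
   If 1/w is integrable, each Fourier coefficient is bounded in the norm of L^2(w), by
   Cauchy-Schwarz.  If some lam_j <> lam_k with c_|k-j| > 0, the criterion bounds |f^(k)|
   by a multiple of ||f||; testing on e_k sum_{n < M} x^n with x = 1 - w/W, W = 4 sum c_k,
   which increases to W/w, forces 1/w to be integrable.  Hence, when it is not, lam is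
   constant along the group generated by the support of c. *)
Require Import Defs.
From HB Require Import structures.
From mathcomp Require Import all_boot all_order all_algebra.
From mathcomp Require Import all_classical all_reals all_analysis.
From mathcomp Require Import measurable_realfun complex.
From mathcomp Require Import ring lra.

Set Implicit Arguments.
Unset Strict Implicit.
Unset Printing Implicit Defensive.

Import Order.TTheory GRing.Theory Num.Theory.
Import numFieldNormedType.Exports.

Local Open Scope classical_set_scope.
Local Open Scope ring_scope.

(** * Complex modulus and integration over the circle *)

Section RealInequalities.
Variable R : realType.

(** Norms stay squared, with |x + y|^2 <= 2 (|x|^2 + |y|^2) in place of the triangle inequality:
    constants are lossy, but only their finiteness matters. The extended operator is, up to null
    functions, T_lambda after the orthogonal projection onto the closure of the trigonometric
    polynomials. Two near projections of one function differ by a polynomial that is nearly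
    orthogonal to all polynomials, itself included, hence small; the bound on polynomials carries
    this over to the images. In the divergent case, multiplication by e_k turns the bound on one
    coefficient into mean(h)^2 <= B mean(h^2 w) for real trigonometric polynomials h, and h = 1/w
    would give mean(1/w) <= B outright. Partial sums g of the Neumann series of W/w stand in for it:
    they satisfy g w <= W, so mean(g^2 w) <= W mean(g). As w need not be a polynomial, its series is
    cut at a rank depending on the number of powers. The group generated by the support of c is
    reached without Bezout: the least positive period divides every k with c_k > 0, hence their
    gcd. *)

Lemma le0_small (x M : R) : (forall e, 0 < e -> x <= M * e) -> x <= 0.
Proof.
move=> h; apply/ler_addgt0Pr => e e0; rewrite add0r.
have M0 : 0 < `|M| + 1 by rewrite ltr_wpDl.
apply: le_trans (h (e / (`|M| + 1)) (divr_gt0 e0 M0)) _.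
rewrite mulrA ler_pdivrMr// mulrC; apply: ler_wpM2l; first exact: ltW.
by apply: le_trans (ler_norm M) _; rewrite lerDl.
Qed.

(** A quadratic that is never negative has no positive discriminant. This is the form in which
    Cauchy-Schwarz arguments are run below. *)
Lemma discriminant_le (n B d : R) : 0 <= n ->
  (forall s, 0 <= s ^+ 2 * n + 2 * s * B + d) -> B ^+ 2 <= d * n.
Proof.
move=> n0 quad; have [nz|nz] := eqVneq n 0.
  suff -> : B = 0 by rewrite nz mulr0 expr0n.
  (* At this argument the affine function 2 s B + d takes the value -1. *)
  apply/eqP; apply: contraT => B0; have := quad (- (d + 1) / (2 * B)).
  rewrite nz mulr0 add0r.
  have -> : 2 * (- (d + 1) / (2 * B)) * B = - (d + 1) by field.
  by lra.
have npos : 0 < n by rewrite lt_neqAle eq_sym nz.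
have := quad (- B / n).
have -> : (- B / n) ^+ 2 * n + 2 * (- B / n) * B + d = d - B ^+ 2 / n by field.
by rewrite subr_ge0 ler_pdivrMr.
Qed.

End RealInequalities.

Section ComplexModulus.
Variable R : realType.
Implicit Types x y z : R[i].

Lemma cabs_sq z : cabs z ^+ 2 = complex.Re z ^+ 2 + complex.Im z ^+ 2.
Proof. by case: z => a b; rewrite /cabs /Normc.normc sqr_sqrtr// addr_ge0 ?sqr_ge0. Qed.

Lemma cabs_ge0 z : 0 <= cabs z.
Proof. by case: z => a b; exact: sqrtr_ge0. Qed.

Lemma cabsM x y : cabs (x * y) = cabs x * cabs y.
Proof. exact: Normc.normcM. Qed.

Lemma cabs_sqM x y : cabs (x * y) ^+ 2 = cabs x ^+ 2 * cabs y ^+ 2.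
Proof. by rewrite cabsM exprMn. Qed.

Lemma cabs_sqN z : cabs (- z) ^+ 2 = cabs z ^+ 2.
Proof. by rewrite !cabs_sq; case: z => a b /=; rewrite !sqrrN. Qed.

(** Substitute for the triangle inequality that keeps moduli squared. *)
Lemma cabs_sqD x y : cabs (x + y) ^+ 2 <= 2 * (cabs x ^+ 2 + cabs y ^+ 2).
Proof.
rewrite !cabs_sq; case: x => a b; case: y => c d /=.
by have := sqr_ge0 (a - c); have := sqr_ge0 (b - d); nra.
Qed.

Lemma cabs_sqB x y : cabs (x - y) ^+ 2 <= 2 * (cabs x ^+ 2 + cabs y ^+ 2).
Proof. by rewrite -(cabs_sqN y) cabs_sqD. Qed.

Lemma Re_sq_le z : complex.Re z ^+ 2 <= cabs z ^+ 2.
Proof. by rewrite cabs_sq lerDl sqr_ge0. Qed.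

Lemma Im_sq_le z : complex.Im z ^+ 2 <= cabs z ^+ 2.
Proof. by rewrite cabs_sq lerDr sqr_ge0. Qed.

Lemma cabs0 : cabs (0 : R[i]) = 0.
Proof. exact: Normc.normc0. Qed.

Lemma cabs_sqC (r : R) : cabs r%:C%C ^+ 2 = r ^+ 2.
Proof. by rewrite cabs_sq /= expr0n addr0. Qed.

Lemma cabs_sq_eq0 z : cabs z ^+ 2 = 0 -> z = 0.
Proof. by move/eqP; rewrite sqrf_eq0 => /eqP /Normc.eq0_normc. Qed.

Lemma ReD x y : complex.Re (x + y) = complex.Re x + complex.Re y.
Proof. by case: x; case: y. Qed.

Lemma ImD x y : complex.Im (x + y) = complex.Im x + complex.Im y.
Proof. by case: x; case: y. Qed.

Lemma ReM x y : complex.Re (x * y) =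
  complex.Re x * complex.Re y - complex.Im x * complex.Im y.
Proof. by case: x; case: y. Qed.

Lemma ImM x y : complex.Im (x * y) =
  complex.Re x * complex.Im y + complex.Im x * complex.Re y.
Proof. by case: x => a b; case: y => c d /=; ring. Qed.

Lemma ReN x : complex.Re (- x) = - complex.Re x.
Proof. by case: x. Qed.

Lemma ImN x : complex.Im (- x) = - complex.Im x.
Proof. by case: x. Qed.

End ComplexModulus.

Section CircleIntegral.
Variable R : realType.
Implicit Types g h : R -> R.
Local Notation I := (@circle_dom R).
Local Notation mu := (@lebesgue_measure R).

Lemma measurable_circle_dom : measurable I.
Proof. exact: measurable_itv. Qed.
Hint Resolve measurable_circle_dom : core.

Lemma twopi_gt0 : 0 < 2 * pi :> R.
Proof. by rewrite mulr_gt0// pi_gt0. Qed.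

Lemma twopi_inv_ge0 : (0 <= (2 * pi)^-1%:E :> \bar R)%E.
Proof. by rewrite lee_fin invr_ge0 ltW// twopi_gt0. Qed.

Lemma lebesgue_circle_dom : mu I = (2 * pi)%:E.
Proof. by rewrite /circle_dom lebesgue_measure_itv/= lte_fin twopi_gt0 oppr0 addr0. Qed.

Lemma circle_int_ge0 g : (forall t, I t -> 0 <= g t) -> (0 <= circle_int g)%E.
Proof.
move=> g0; rewrite mule_ge0 ?twopi_inv_ge0//.
by apply: integral_ge0 => t It; rewrite lee_fin g0.
Qed.

(** Comparison almost everywhere is what estimates with 1/w require, because the inverse is 0 by
    convention at the zeros of w. *)
Lemma ae_le_circle_int g h : measurable_fun I g -> measurable_fun I h ->
  (forall t, I t -> 0 <= g t) -> (forall t, I t -> 0 <= h t) ->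
  {ae mu, forall t, I t -> g t <= h t} -> (circle_int g <= circle_int h)%E.
Proof.
move=> mg mh g0 h0 gh; rewrite lee_pmul2l//; last first.
  by rewrite lte_fin invr_gt0 twopi_gt0.
apply: ae_ge0_le_integral => //.
- exact/measurable_EFinP.
- exact/measurable_EFinP.
Qed.

Lemma le_circle_int g h : measurable_fun I g -> measurable_fun I h ->
  (forall t, I t -> 0 <= g t <= h t) -> (circle_int g <= circle_int h)%E.
Proof.
move=> mg mh gh; apply: ae_le_circle_int => //.
- by move=> t /gh/andP[].
- by move=> t /gh/andP[]; exact: le_trans.
by apply: aeW => t /gh/andP[].
Qed.

Lemma eq_circle_int g h : (forall t, I t -> g t = h t) -> circle_int g = circle_int h.
Proof.
move=> gh; congr (_ * _)%E; apply: eq_integral => t; rewrite inE => It.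
by rewrite gh.
Qed.

Lemma circle_intZl (k : R) g : measurable_fun I g -> (forall t, I t -> 0 <= g t) -> 0 <= k ->
  circle_int (fun t => k * g t) = (k%:E * circle_int g)%E.
Proof.
move=> mg g0 k0; rewrite /circle_int muleCA; congr (_ * _)%E; rewrite -ge0_integralZl//.
exact/measurable_EFinP.
Qed.

Lemma circle_intD g h : measurable_fun I g -> measurable_fun I h ->
  (forall t, I t -> 0 <= g t) -> (forall t, I t -> 0 <= h t) ->
  circle_int (fun t => g t + h t) = (circle_int g + circle_int h)%E.
Proof.
move=> mg mh g0 h0; rewrite /circle_int.
have ig (f : R -> R) : (forall t, I t -> 0 <= f t) -> (0 <= \int[mu]_(t in I) (f t)%:E)%E.
  by move=> f0; apply: integral_ge0 => t It; rewrite lee_fin f0.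
rewrite -ge0_muleDr ?ig//; congr (_ * _)%E.
by rewrite -ge0_integralD//; exact/measurable_EFinP.
Qed.

Lemma circle_int_cst (k : R) : circle_int (fun _ => k) = k%:E.
Proof.
rewrite /circle_int integral_cst// [X in ((_ : \bar R) * (_ * X))%E]lebesgue_circle_dom.
by rewrite -!EFinM mulrCA mulVf ?mulr1// gt_eqF// twopi_gt0.
Qed.

Lemma bounded_L1 g (M : R) : measurable_fun I g -> (forall t, I t -> `|g t| <= M) -> L1 g.
Proof.
move=> mg gM; apply: measurable_bounded_integrable => //.
  by rewrite [X in (X < _)%E]lebesgue_circle_dom ltry.
exists M; split; first exact: num_real.
by move=> x Mx t It /=; apply: (le_trans (gM t It)); exact: ltW.
Qed.

Lemma integral_circle_int g :
  (\int[mu]_(t in I) (g t)%:E)%E = ((2 * pi)%:E * circle_int g)%E.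
Proof.
by rewrite /circle_int muleA -EFinM mulfV ?mul1e// gt_eqF// twopi_gt0.
Qed.

Lemma L1P g : measurable_fun I g -> (forall t, I t -> 0 <= g t) ->
  L1 g <-> (circle_int g < +oo)%E.
Proof.
move=> mg g0; have e : (\int[mu]_(t in I) `|(g t)%:E| = (2 * pi)%:E * circle_int g)%E.
  rewrite -integral_circle_int; apply: eq_integral => t; rewrite inE => It.
  by rewrite /= ger0_norm// g0.
split=> [/integrableP[_]|gfin].
  rewrite e; have := circle_int_ge0 g0; case: (circle_int g) => [r _ _||_]//; first exact: ltry.
  by rewrite gt0_muley// lte_fin twopi_gt0.
apply/integrableP; split; first exact/measurable_EFinP.
by rewrite e lte_mul_pinfty// lee_fin ltW// twopi_gt0.
Qed.

(** No integrability is asked: an infinite integral becomes 0 on both sides. *)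
Lemma fine_circle_int g :
  fine (circle_int g) = (2 * pi)^-1 * Rintegral mu I g.
Proof.
rewrite /circle_int /Rintegral; case: (integral _ _ _) => [r| |]//=.
  by rewrite gt0_muley/= ?mulr0// lte_fin invr_gt0 twopi_gt0.
by rewrite gt0_muleNy/= ?mulr0// lte_fin invr_gt0 twopi_gt0.
Qed.

End CircleIntegral.


(** * The space L^2(w) and extension of bounded operators *)

Section WeightedL2.
Variables (R : realType) (w : R -> R).
Implicit Types f g u v p q : R -> R[i].
Local Notation I := (@circle_dom R).
Local Notation mu := (@lebesgue_measure R).

Let mI := @measurable_circle_dom R.
#[local] Hint Resolve mI : core.

Hypothesis w_ge0 : forall t, 0 <= w t.
Hypothesis mw : measurable_fun I w.

Definition cmeasurable f :=
  measurable_fun I (fun t => complex.Re (f t)) /\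
  measurable_fun I (fun t => complex.Im (f t)).

Lemma L2P f : L2 w f <-> cmeasurable f /\ (normsq w f < +oo)%E.
Proof. by split => [[? ? ?]|[[? ?] ?]]; split. Qed.

Lemma cmeasurable_lin (a : R[i]) f g : cmeasurable f -> cmeasurable g ->
  cmeasurable (fun t => a * f t + g t).
Proof.
move=> [mf1 mf2] [mg1 mg2]; split.
  under eq_fun do rewrite ReD ReM.
  apply: measurable_funD => //; apply: measurable_funB; apply: measurable_funM => //.
under eq_fun do rewrite ImD ImM.
by apply: measurable_funD => //; apply: measurable_funD; apply: measurable_funM.
Qed.

Lemma cmeasurableM f g : cmeasurable f -> cmeasurable g ->
  cmeasurable (fun t => f t * g t).
Proof.
move=> [mf1 mf2] [mg1 mg2]; split.
  under eq_fun do rewrite ReM.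
  by apply: measurable_funB; apply: measurable_funM.
under eq_fun do rewrite ImM.
by apply: measurable_funD; apply: measurable_funM.
Qed.

Lemma cmeasurable_cst (a : R[i]) : cmeasurable (fun=> a).
Proof. by split; exact: measurable_cst. Qed.

Lemma measurable_cabs_sq f : cmeasurable f ->
  measurable_fun I (fun t => cabs (f t) ^+ 2).
Proof.
move=> [mf1 mf2]; under eq_fun do rewrite cabs_sq.
by apply: measurable_funD; apply: measurable_funX.
Qed.

Lemma measurable_density f : cmeasurable f ->
  measurable_fun I (fun t => cabs (f t) ^+ 2 * w t).
Proof. by move=> mf; apply: measurable_funM => //; exact: measurable_cabs_sq. Qed.

Lemma density_ge0 f t : 0 <= cabs (f t) ^+ 2 * w t.
Proof. by rewrite mulr_ge0// sqr_ge0. Qed.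
Hint Resolve density_ge0 : core.

Lemma normsq_ge0 f : (0 <= normsq w f)%E.
Proof. exact: circle_int_ge0. Qed.

Lemma normsqZ (a : R[i]) f : cmeasurable f ->
  normsq w (fun t => a * f t) = ((cabs a ^+ 2)%:E * normsq w f)%E.
Proof.
move=> mf; rewrite /normsq -circle_intZl//; last 2 first.
  exact: measurable_density.
  exact: sqr_ge0.
by apply: eq_circle_int => t It; rewrite cabs_sqM mulrA.
Qed.

Lemma normsqD f g : cmeasurable f -> cmeasurable g ->
  (normsq w (fun t => f t + g t)%R <= 2%:E * (normsq w f + normsq w g))%E.
Proof.
move=> mf mg; have mdf := measurable_density mf; have mdg := measurable_density mg.
rewrite /normsq -circle_intD// -circle_intZl//; last 2 first.
- exact: measurable_funD.
- by move=> t It; rewrite addr_ge0.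
apply: le_circle_int.
- apply: measurable_density; have := cmeasurable_lin 1 mf mg.
  by under eq_fun do rewrite mul1r.
- by apply: measurable_funM => //; exact: measurable_funD.
move=> t It; rewrite mulr_ge0 ?sqr_ge0//= -mulrDl mulrA.
by rewrite ler_wpM2r// cabs_sqD.
Qed.

Lemma L2_lin (a : R[i]) f g : L2 w f -> L2 w g -> L2 w (fun t => a * f t + g t).
Proof.
move=> /L2P[mf nf] /L2P[mg ng]; apply/L2P; split; first exact: cmeasurable_lin.
have maf : cmeasurable (fun t => a * f t).
  have := cmeasurable_lin a mf (cmeasurable_cst 0).
  by under eq_fun do rewrite addr0.
apply: le_lt_trans (normsqD maf mg) _.
rewrite normsqZ// lte_mul_pinfty//.
by rewrite lte_add_pinfty// lte_mul_pinfty// lee_fin sqr_ge0.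
Qed.

Lemma L2_0 : L2 w (fun=> 0).
Proof.
apply/L2P; split; first exact: cmeasurable_cst.
rewrite /normsq (@eq_circle_int _ _ (fun=> 0)) ?circle_int_cst ?ltry//.
by move=> t _; rewrite cabs0 expr0n mul0r.
Qed.

Lemma L2Z (a : R[i]) f : L2 w f -> L2 w (fun t => a * f t).
Proof.
by move=> Lf; have := L2_lin a Lf L2_0; under eq_fun do rewrite addr0.
Qed.

Lemma L2D f g : L2 w f -> L2 w g -> L2 w (fun t => f t + g t).
Proof.
by move=> Lf Lg; have := L2_lin 1 Lf Lg; under eq_fun do rewrite mul1r.
Qed.

Lemma L2B f g : L2 w f -> L2 w g -> L2 w (fun t => f t - g t).
Proof.
move=> Lf Lg; have := L2_lin (-1) Lg Lf.
by under eq_fun do rewrite mulN1r addrC.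
Qed.

(* The real part of the inner product of L^2(w). *)
Definition inner f g : R := (2 * pi)^-1 * Rintegral mu I (fun t =>
  (complex.Re (f t) * complex.Re (g t) + complex.Im (f t) * complex.Im (g t)) * w t).

(** The squared norm as a real number. It is faithful only on [L2 w], since [fine] sends +oo to
    0. *)
Definition nrm f : R := fine (normsq w f).

Lemma nrmE f : L2 w f -> normsq w f = (nrm f)%:E.
Proof. by move=> /L2P[_ nf]; rewrite /nrm fineK// ge0_fin_numE// normsq_ge0. Qed.

Lemma nrm0 : nrm (fun=> 0) = 0.
Proof.
rewrite /nrm /normsq (@eq_circle_int _ _ (fun=> 0)) ?circle_int_cst// => t _.
by rewrite cabs0 expr0n mul0r.
Qed.

Lemma nrm_ge0 f : 0 <= nrm f.
Proof. by rewrite fine_ge0// normsq_ge0. Qed.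

Lemma nrmZ a f : L2 w f -> nrm (fun t => a * f t) = cabs a ^+ 2 * nrm f.
Proof.
move=> Lf; have [mf _] := (L2P f).1 Lf.
by apply: EFin_inj; rewrite EFinM -!nrmE ?normsqZ//; exact: L2Z.
Qed.

Lemma nrmD f g : L2 w f -> L2 w g -> nrm (fun t => f t + g t) <= 2 * (nrm f + nrm g).
Proof.
move=> Lf Lg; rewrite -lee_fin EFinM (EFinD (nrm f)) -!nrmE//; last exact: L2D.
by apply: normsqD; [case/L2P: Lf|case/L2P: Lg].
Qed.

Lemma nrmB f g : L2 w f -> L2 w g -> nrm (fun t => f t - g t) <= 2 * (nrm f + nrm g).
Proof.
move=> Lf Lg; have := nrmD Lf (L2Z (-1) Lg).
under eq_fun do rewrite mulN1r.
by rewrite nrmZ// cabs_sqN cabs_sqC expr1n mul1r.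
Qed.

(** The integrand is dominated by |f|^2 w + |g|^2 w. *)
Lemma inner_integrable f g : L2 w f -> L2 w g ->
  mu.-integrable I (EFin \o (fun t => (complex.Re (f t) * complex.Re (g t) +
    complex.Im (f t) * complex.Im (g t)) * w t)).
Proof.
move=> /L2P[mf nf] /L2P[mg ng].
have ii u : cmeasurable u -> (normsq w u < +oo)%E ->
    mu.-integrable I (EFin \o (fun t => cabs (u t) ^+ 2 * w t)).
  by move=> mu' nu; apply/L1P => //; exact: measurable_density.
have := @integrableD _ _ _ mu I (@measurable_circle_dom R) _ _ (ii _ mf nf) (ii _ mg ng).
apply: le_integrable; first exact: measurable_circle_dom.
  apply/measurable_EFinP; case: mf mg => [? ?] [? ?].
  by apply: measurable_funM => //; apply: measurable_funD; apply: measurable_funM.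
move=> t It /=; rewrite lee_fin normrM (ger0_norm (w_ge0 t)) -mulrDl.
rewrite normrM (ger0_norm (w_ge0 t)) ler_wpM2r//.
rewrite [leRHS]ger0_norm ?addr_ge0 ?sqr_ge0// !cabs_sq ler_norml.
move: (complex.Re _) (complex.Re _) (complex.Im _) (complex.Im _) => a b c d.
have := sqr_ge0 (a - b); have := sqr_ge0 (c - d).
have := sqr_ge0 (a + b); have := sqr_ge0 (c + d).
by move=> ? ? ? ?; apply/andP; split; nra.
Qed.

Lemma inner_nrm f : inner f f = nrm f.
Proof.
rewrite /nrm fine_circle_int; congr (_ * _); apply: eq_Rintegral => t _.
by rewrite cabs_sq !expr2.
Qed.

Lemma innerC f g : inner f g = inner g f.
Proof.
by congr (_ * _); apply: eq_Rintegral => t _; congr (_ * _); congr (_ + _); rewrite mulrC.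
Qed.

Lemma innerDl f g h : L2 w f -> L2 w g -> L2 w h ->
  inner (fun t => f t + g t) h = inner f h + inner g h.
Proof.
move=> Lf Lg Lh; rewrite /inner -mulrDr -RintegralD//; try exact: inner_integrable.
congr (_ * _); apply: eq_Rintegral => t _.
by rewrite -mulrDl ReD ImD !mulrDl addrACA.
Qed.

(** A complex scalar cannot leave the real part of an inner product, but it can change sides. The
    two integrands are equal pointwise, so no integrability is asked. *)
Lemma innerZl (a : R[i]) f h :
  inner (fun t => a * f t) h = inner f (fun t => conjc a * h t).
Proof.
congr (_ * _); apply: eq_Rintegral => t _; congr (_ * _).
by rewrite !ReM !ImM; case: a => a b /=; ring.
Qed.

Lemma innerCZl (r : R) f h : L2 w f -> L2 w h ->
  inner (fun t => r%:C%C * f t) h = r * inner f h.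
Proof.
move=> Lf Lh; rewrite /inner mulrCA; congr (_ * _).
rewrite -RintegralZl//; last exact: inner_integrable.
by apply: eq_Rintegral => t _; rewrite ReM ImM/= !mul0r subr0 addr0 mulrA mulrDr !mulrA.
Qed.

Lemma nrm_lin (s : R) f g : L2 w f -> L2 w g ->
  nrm (fun t => s%:C%C * f t + g t) = s ^+ 2 * nrm f + 2 * s * inner g f + nrm g.
Proof.
move=> Lf Lg; have Lsf := L2Z s%:C%C Lf; have Ls := L2D Lsf Lg.
rewrite -inner_nrm innerDl// innerC innerDl// [X in _ + X]innerC innerDl//.
rewrite !inner_nrm nrmZ// cabs_sqC innerCZl// [inner g _]innerC innerCZl//.
by rewrite [inner f g]innerC; ring.
Qed.

(** * Completeness of L^2(w) *)

Lemma cvg_geometric_increments (u : nat -> R) (K : R) :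
  (forall k, `|u k.+1 - u k| <= K * 2^-1 ^+ k) -> cvgn u.
Proof.
move=> uK; have -> : u = (fun n => u 0%N + series (telescope u) n).
  by apply/funext => n; exact: eq_sum_telescope.
apply: is_cvgD; first exact: is_cvg_cst.
apply: normed_cvg; apply: (@series_le_cvg _ _ (geometric K 2^-1)).
- by move=> n; exact: normr_ge0.
- by move=> n /=; apply: le_trans (uK n).
- by move=> n; exact: uK.
- by apply: is_cvg_geometric_series; rewrite ger0_norm ?invr_ge0// invf_lt1 ?ltr1n.
Qed.

(** The first increment is split off, so that the remaining ones start at k + 1 and gain a factor
    1/8. This pays for the doubling in [nrmD]: 2 (4 K / 8 + K) = 3 K <= 4 K. *)
Lemma nrm_telescope (g : nat -> R -> R[i]) (K : R) :
  (forall k, L2 w (g k)) ->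
  (forall k, nrm (fun t => g k.+1 t - g k t) <= K * 8^-1 ^+ k) ->
  forall r k, nrm (fun t => g (k + r)%N t - g k t) <= 4 * K * 8^-1 ^+ k.
Proof.
move=> Lg gK.
have K0 : 0 <= K by have := gK 0%N; rewrite expr0 mulr1; exact: le_trans (nrm_ge0 _).
have e0 k : 0 <= 8^-1 ^+ k :> R by rewrite exprn_ge0// invr_ge0.
elim=> [|r IH] k.
  rewrite addn0; have -> : (fun t => g k t - g k t) = (fun t => 0 * g k t).
    by apply/funext => t; rewrite subrr mul0r.
  by rewrite nrmZ// cabs0 expr0n mul0r mulr_ge0// mulr_ge0.
have -> : (fun t => g (k + r.+1)%N t - g k t) =
    (fun t => (g (k.+1 + r)%N t - g k.+1 t) + (g k.+1 t - g k t)).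
  by apply/funext => t; rewrite addnS addSn addrA subrK.
apply: le_trans (nrmD (L2B (Lg _) (Lg _)) (L2B (Lg _) (Lg _))) _.
have := IH k.+1; have := gK k; rewrite exprS.
have := mulr_ge0 K0 (e0 k).
lra.
Qed.

(* Off a null set the series of 4^k |g_(k+1) - g_k|^2 w converges; where in addition
   w > 0 the increments of g_k are O(2^-k). *)
Lemma L2_complete (g : nat -> R -> R[i]) (K : R) :
  (forall k, L2 w (g k)) ->
  (forall k, nrm (fun t => g k.+1 t - g k t) <= K * 8^-1 ^+ k) ->
  exists2 f, L2 w f & forall k, nrm (fun t => f t - g k t) <= 4 * K * 8^-1 ^+ k.
Proof.
move=> Lg gK.
have K0 : 0 <= K by have := gK 0%N; rewrite expr0 mulr1; exact: le_trans (nrm_ge0 _).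
have LB i j : L2 w (fun t => g i t - g j t) by exact: L2B.
have mD i j : cmeasurable (fun t => g i t - g j t) by case/L2P: (LB i j).
(* The factor 4^k meets two needs: against 8^-k the integrals of [h k] remain summable, and a bound
   on [h k t] uniform in k makes the increments O(2^-k). *)
pose h k t := 4 ^+ k * (cabs (g k.+1 t - g k t) ^+ 2 * w t).
have h0 k t : 0 <= h k t by apply: mulr_ge0; [exact: exprn_ge0|exact: mulr_ge0 (sqr_ge0 _) (w_ge0 _)].
have mh k : measurable_fun I (h k).
  by apply: measurable_funM => //; exact: measurable_density (mD _ _).
pose S t := (\sum_(0 <= k <oo) (h k t)%:E)%E.
have SfinI : mu.-integrable I S.
  apply/integrableP; split.
    apply: ge0_emeasurable_sum => [k t _ _|k _]; first by rewrite lee_fin.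
    by apply/measurable_EFinP; exact: mh.
  have S0 t : (0 <= S t)%E by apply: nneseries_ge0 => k _ _; rewrite lee_fin.
  under eq_integral => t _ do rewrite gee0_abs//.
  rewrite integral_nneseries//; last 2 first.
    - by move=> k; apply/measurable_EFinP; exact: mh.
    - by move=> k t _; rewrite lee_fin.
  (* The k-th integral is at most 2 pi K 2^-k, and these bounds add up to 2 (2 pi K). *)
  apply: le_lt_trans (_ : (2 * (2 * pi * K))%:E < +oo)%E; last exact: ltry.
  have e40 k : 0 <= 4 ^+ k :> R by rewrite exprn_ge0.
  have P0 : 0 <= 2 * (2 * pi * K) by rewrite mulr_ge0// mulr_ge0// ltW// twopi_gt0.
  apply: le_trans (epsilon_trick0 xpredT P0); apply: lee_nneseries => k _.
    by move=> _; apply: integral_ge0 => t _; rewrite lee_fin.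
  have dens0 t : 0 <= cabs (g k.+1 t - g k t) ^+ 2 * w t by exact: mulr_ge0 (sqr_ge0 _) (w_ge0 _).
  rewrite integral_circle_int circle_intZl//; try exact: measurable_density (mD _ _).
  have -> : circle_int (fun t => cabs (g k.+1 t - g k t) ^+ 2 * w t) =
    (nrm (fun t => g k.+1 t - g k t))%:E by rewrite -nrmE.
  rewrite -!EFinM lee_fin natrX exprS.
  have -> : 2 * (2 * pi * K) / (2 * 2 ^+ k) = 2 * pi * (4 ^+ k * (K * 8^-1 ^+ k)).
    have -> : (8^-1 : R) = 4^-1 * 2^-1 by field.
    rewrite exprMn (exprVn 4) (exprVn 2).
    have e4 : 4 ^+ k != 0 :> R by rewrite expf_neq0.
    have e2 : 2 ^+ k != 0 :> R by rewrite expf_neq0.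
    by field; rewrite e4 e2.
  by apply: ler_wpM2l; [rewrite ltW// twopi_gt0|exact: ler_wpM2l].
(* An upper limit is measurable and defined at every point, also where the sequence diverges; [fine]
   supplies 0 where it is infinite. *)
pose lim_part (P : R[i] -> R) t := fine (limn_esup (fun k => (P (g k t))%:E)).
pose f t := (lim_part (@complex.Re R) t +i* lim_part (@complex.Im R) t)%C.
have mf : cmeasurable f.
  have ml (P : R[i] -> R) : (forall k, measurable_fun I (fun t => P (g k t))) ->
      measurable_fun I (lim_part P).
    move=> mP; apply: (measurableT_comp (fine_measurable measurableT)).
    by apply: measurable_fun_limn_esup => k; apply/measurable_EFinP; exact: mP.
  by split; apply: ml => k; case/L2P: (Lg k) => -[].
have cvgP t (P : R[i] -> R) : {morph P : x y / x - y} ->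
    (forall z, P z ^+ 2 <= cabs z ^+ 2) ->
    S t \is a fin_num -> 0 < w t -> P (g k t) @[k --> \oo] --> lim_part P t.
  move=> PB Pc St wt.
  have : cvgn (fun k => P (g k t)).
    pose q := Num.sqrt (fine (S t) / w t).
    apply: (@cvg_geometric_increments _ q) => k.
    rewrite -PB; have q0 : 0 <= q by exact: sqrtr_ge0.
    rewrite -(@ler_pXn2r _ 2)// ?nnegrE ?mulr_ge0 ?exprn_ge0// real_normK ?num_real//.
    apply: le_trans (Pc _) _.
    have : ((h k t)%:E <= S t)%E.
      apply: (@le_trans _ _ (\sum_(0 <= i < k.+1) (h i t)%:E)%E); last first.
        by apply: nneseries_lim_ge => i _ _; rewrite lee_fin.
      by rewrite big_nat_recr//= leeDr// sume_ge0// => i _; rewrite lee_fin.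
    rewrite -(fineK St) lee_fin /h => hS.
    have s0 : 0 <= fine (S t) by apply: fine_ge0; apply: nneseries_ge0 => i _ _; rewrite lee_fin.
    have -> : (q * 2^-1 ^+ k) ^+ 2 = fine (S t) / w t / 4 ^+ k.
      rewrite exprMn sqr_sqrtr; last by rewrite divr_ge0// ltW.
      congr (_ * _); rewrite -exprM mulnC exprM -exprVn; congr (_ ^+ k).
      by rewrite expr2; field.
    by rewrite ler_pdivlMr ?exprn_gt0// ler_pdivlMr// -mulrA mulrCA.
  move=> cv; rewrite /lim_part.
  have e : (P (g k t))%:E @[k --> \oo] --> (limn (fun k => P (g k t)))%:E.
    by apply/fine_cvgP; split; [exact: nearW|exact: cv].
  by rewrite (cvg_limn_einf_sup e).
have fk k t : S t \is a fin_num ->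
  limn_einf (fun m => (cabs (g (k + m)%N t - g k t) ^+ 2 * w t)%:E) =
    (cabs (f t - g k t) ^+ 2 * w t)%:E.
  (* Where w vanishes nothing is known about the convergence of [g], but both sides are 0. *)
  move=> St; have [wt|] := ltP 0 (w t); last first.
    move=> wt; have -> : w t = 0 by apply/eqP; rewrite eq_le wt w_ge0.
    rewrite mulr0; under eq_fun do rewrite mulr0.
    have z : 0%:E @[_ --> \oo] --> (0%:E : \bar R) by exact: cvg_cst.
    by rewrite (cvg_limn_einf_sup z).
  apply: (cvg_limn_einf_sup _).1; apply/fine_cvgP; split; first exact: nearW.
  rewrite /comp/=; apply: cvgM; last exact: cvg_cst.
  have cvgBX (P : R[i] -> R) : {morph P : x y / x - y} ->
      (forall z, P z ^+ 2 <= cabs z ^+ 2) -> P (f t) = lim_part P t ->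
      P (g (k + m)%N t - g k t) ^+ 2 @[m --> \oo] --> P (f t - g k t) ^+ 2.
    move=> PB Pc Pf.
    have c1 : P (g (k + m)%N t) - P (g k t) @[m --> \oo] --> lim_part P t - P (g k t).
      apply: cvgB; last exact: cvg_cst.
      under eq_fun do rewrite addnC.
      by have := cvgP t P PB Pc St wt; rewrite -(cvg_shiftn k).
    by rewrite PB Pf expr2; under eq_fun do rewrite PB expr2; exact: cvgM.
  under eq_fun do rewrite cabs_sq; rewrite cabs_sq.
  apply: cvgD; apply: cvgBX => //.
  - by move=> x y; rewrite ReD ReN.
  - by move=> z; rewrite cabs_sq lerDl sqr_ge0.
  - by move=> x y; rewrite ImD ImN.
  - by move=> z; rewrite cabs_sq lerDr sqr_ge0.
have le_fk k : (normsq w (fun t => f t - g k t)%R <= (4 * K * 8^-1 ^+ k)%:E)%E.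
  rewrite -(@lee_pmul2l _ (2 * pi)%:E) ?lte_fin ?twopi_gt0// -integral_circle_int.
  (* Almost everywhere the density of f - g k is the lower limit of the [d m], so Fatou's lemma
     applies; [nrm_telescope] bounds the integral of each [d m]. *)
  pose d m t := (cabs (g (k + m)%N t - g k t) ^+ 2 * w t)%:E.
  have md m : measurable_fun I (d m).
    by apply/measurable_EFinP; exact: measurable_density (mD _ _).
  apply: (@le_trans _ _ (\int[mu]_(t in I) limn_einf (d ^~ t))%E).
    apply: ae_ge0_le_integral => //.
    - by move=> t _; rewrite lee_fin; exact: mulr_ge0 (sqr_ge0 _) (w_ge0 _).
    - apply/measurable_EFinP; apply: measurable_density.
      have := cmeasurable_lin (-1) (proj1 ((L2P _).1 (Lg k))) mf.
      by under eq_fun do rewrite mulN1r addrC.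
    - move=> t _; rewrite limn_einf_lim; apply: lime_ge; first exact: is_cvg_einfs.
      apply: nearW => n; apply: le_ereal_inf_tmp => _ [i _ <-].
      by rewrite lee_fin; exact: mulr_ge0 (sqr_ge0 _) (w_ge0 _).
    - apply: (@measurableT_comp _ _ _ _ _ _ (@oppe R)) => //.
      by apply: measurable_fun_limn_esup => n; apply: measurableT_comp => //; exact: md.
    - have := @integrable_ae _ _ _ mu I mI S SfinI; apply: filterS => t St It.
      by rewrite fk// St.
  apply: le_trans (@fatou _ _ _ mu I mI d md _) _.
    by move=> m t _; rewrite lee_fin; exact: mulr_ge0 (sqr_ge0 _) (w_ge0 _).
  rewrite limn_einf_lim; apply: lime_le; first exact: is_cvg_einfs.
  apply: nearW => m.
  apply: (@le_trans _ _ (\int[mu]_(t in I) d m t)%E).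
    by apply: ereal_inf_lbound; exists m => /=.
  rewrite integral_circle_int lee_pmul2l ?lte_fin ?twopi_gt0//.
  by rewrite -[circle_int _]/(normsq w (fun t => g (k + m)%N t - g k t)) nrmE// lee_fin nrm_telescope.
have Lf : L2 w f.
  have -> : f = (fun t => (f t - g 0%N t) + g 0%N t) by apply/funext => t; rewrite subrK.
  apply: L2D => //; apply/L2P; split; last by rewrite (le_lt_trans (le_fk 0%N))// ltry.
  have := cmeasurable_lin (-1) (proj1 ((L2P _).1 (Lg 0%N))) mf.
  by under eq_fun do rewrite mulN1r addrC.
by exists f => // k; rewrite -lee_fin -nrmE//; exact: L2B.
Qed.

(** * Extension of a bounded operator given by its graph *)

Section Extension.
Variables (G : (R -> R[i]) -> (R -> R[i]) -> Prop) (K : R).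
Hypothesis GL2 : forall p q, G p q -> L2 w p /\ L2 w q.
Hypothesis G0 : G (fun=> 0) (fun=> 0).
Hypothesis Glin : forall a p q p' q', G p q -> G p' q' ->
  G (fun t => a * p t + p' t) (fun t => a * q t + q' t).
Hypothesis K_ge0 : 0 <= K.
Hypothesis Gbound : forall p q, G p q -> nrm q <= K * nrm p.

Let L2l p q (pq : G p q) : L2 w p := proj1 (GL2 pq).
Let L2r p q (pq : G p q) : L2 w q := proj2 (GL2 pq).

Let GB p q p' q' : G p q -> G p' q' -> G (fun t => p t - p' t) (fun t => q t - q' t).
Proof.
move=> pq pq'; have := Glin (-1) pq' pq.
by congr (G _ _); apply/funext => t; rewrite mulN1r addrC.
Qed.

Definition nearly_orth (d : R) u := forall p q, G p q -> inner u p ^+ 2 <= d * nrm p.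

Lemma nearly_orthD d e u v : L2 w u -> L2 w v -> nearly_orth d u -> nearly_orth e v ->
  nearly_orth (2 * (d + e)) (fun t => u t + v t).
Proof.
move=> Lu Lv ou ov p q pq; rewrite innerDl//; last exact: L2l pq.
have := ou _ _ pq; have := ov _ _ pq; have := sqr_ge0 (inner u p - inner v p).
nra.
Qed.

(** The scalar moves to the test function, and the domain is stable under complex scalars. This is
    why the real part of the inner product suffices to express orthogonality. *)
Lemma nearly_orthZ d a u : L2 w u -> nearly_orth d u ->
  nearly_orth (cabs a ^+ 2 * d) (fun t => a * u t).
Proof.
move=> Lu ou p q pq; have Lp := L2l pq; rewrite innerZl.
have := ou _ _ (Glin (conjc a) pq G0).
under [X in inner u X]eq_fun do rewrite addr0; under [X in nrm X]eq_fun do rewrite addr0.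
rewrite nrmZ// => /le_trans; apply.
by rewrite [cabs _ ^+ 2]cabs_sq [in leRHS]cabs_sq; case: (a) => x y /=; rewrite sqrrN; nra.
Qed.

(** Test [p] against itself. All uniqueness and Cauchy estimates below rest on this. *)
Lemma nearly_orth_nrm d p q : 0 <= d -> G p q -> nearly_orth d p -> nrm p <= d.
Proof.
move=> d0 pq /(_ _ _ pq); rewrite inner_nrm expr2.
have [->//|p0] := eqVneq (nrm p) 0.
by rewrite ler_pM2r// lt_neqAle eq_sym p0 nrm_ge0.
Qed.

(** Take [p] whose squared distance to [f] is within [d] of the infimum. Moving [p] along a domain
    vector u lowers the squared distance by at most [d], so a quadratic in the step length is never
    negative, and its discriminant gives the near orthogonality. The last bound holds because 0
    competes with [p]. *)
Lemma near_projection d f : L2 w f -> 0 < d -> exists p q, [/\ G p q,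
  nearly_orth d (fun t => f t - p t) & nrm (fun t => f t - p t) <= nrm f + d].
Proof.
move=> Lf d0.
pose E := [set x : R | exists p q, G p q /\ x = nrm (fun t => f t - p t)].
have Ef : E (nrm f).
  exists (fun=> 0), (fun=> 0); split=> //.
  by congr nrm; apply/funext => t; rewrite subr0.
have infE : has_inf E.
  by split; [exists (nrm f)|exists 0 => _ [p [q [_ ->]]]; exact: nrm_ge0].
have [_ [p [q [pq ->]]] pd] := inf_adherent d0 infE.
have lb p' q' : G p' q' -> nrm (fun t => f t - p t) <= nrm (fun t => f t - p' t) + d.
  move=> pq'; apply: le_trans (ltW pd) _; rewrite lerD2r.
  by apply: ge_inf; [exact: infE.2|exists p', q'].
exists p, q; split=> //; last first.
  have := lb _ _ G0; congr (_ <= nrm _ + _).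
  by apply/funext => t; rewrite subr0.
move=> u v uv; have Lu := L2l uv; have Lfp := L2B Lf (L2l pq).
pose B := inner (fun t => f t - p t) u.
have quad s : 0 <= s ^+ 2 * nrm u + 2 * s * B + d.
  have := lb _ _ (Glin (- s)%:C%C uv pq).
  have -> : (fun t => f t - ((- s)%:C%C * u t + p t)) = (fun t => s%:C%C * u t + (f t - p t)).
    apply/funext => t; have -> : ((- s)%:C%C = - s%:C%C :> R[i]) by rewrite rmorphN.
    by ring.
  by rewrite nrm_lin// -/B; lra.
by apply: discriminant_le quad; exact: nrm_ge0.
Qed.

(* [g] is the limit of the G-images of near projections of [f] onto the domain of G. *)
Definition ext_rel f g := L2 w g /\ forall e, 0 < e -> exists p q,
  [/\ G p q, nearly_orth e (fun t => f t - p t),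
      nrm (fun t => f t - p t) <= nrm f + e & nrm (fun t => g t - q t) <= e].

Lemma ext_rel_graph p q : G p q -> ext_rel p q.
Proof.
move=> pq; split=> [|e e0]; first exact: L2r pq.
have Lp := L2l pq; have Lq := L2r pq.
have z u : (fun t => u t - u t) = (fun t => 0 * u t) :> (R -> R[i]).
  by apply/funext => t; rewrite subrr mul0r.
exists p, q; split=> //; rewrite z.
- move=> u v uv; have Lu := L2l uv; rewrite innerZl.
  have -> : (fun t => conjc 0 * u t) = (fun t => 0%:C%C * u t) by rewrite conjc0.
  by rewrite innerC innerCZl// mul0r expr0n mulr_ge0 ?nrm_ge0// ltW.
- by rewrite nrmZ// cabs0 expr0n mul0r addr_ge0 ?nrm_ge0// ltW.
- by rewrite nrmZ// cabs0 expr0n mul0r ltW.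
Qed.

(** With a near projection p of f and its image q, nrm p <= 4 nrm f + 2 e and nrm g <= 2 e + 2 K nrm
    p; the factor 8 is what remains as e tends to 0. *)
Lemma ext_rel_bound f g : L2 w f -> ext_rel f g -> nrm g <= 8 * K * nrm f.
Proof.
move=> Lf [Lg fg]; rewrite -subr_le0; apply: (@le0_small R _ (2 + 4 * K)) => e e0.
have [p [q [pq _ fp gq]]] := fg _ e0.
have Lp := L2l pq; have Lq := L2r pq.
have ep : nrm p <= 2 * (nrm f + nrm (fun t => f t - p t)).
  have := nrmB Lf (L2B Lf Lp); congr (nrm _ <= _); apply/funext => t; ring.
have eg : nrm g <= 2 * (nrm (fun t => g t - q t) + nrm q).
  have := nrmD (L2B Lg Lq) Lq; congr (nrm _ <= _); apply/funext => t; ring.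
have := Gbound pq.
have : K * nrm p <= K * (2 * (nrm f + (nrm f + e))).
  by apply: ler_wpM2l => //; lra.
by lra.
Qed.

(** In P - (a p + p') the functions being projected cancel, so this element of the domain is nearly
    orthogonal to the domain, hence small, and so is its image. For a = 0 the lemma says that the
    extension is unique up to null functions. *)
Lemma ext_rel_lin a f g f' g' h : L2 w f -> L2 w f' ->
  ext_rel f g -> ext_rel f' g' -> ext_rel (fun t => a * f t + f' t) h ->
  nrm (fun t => h t - (a * g t + g' t)) = 0.
Proof.
move=> Lf Lf' [Lg fg] [Lg' fg'] [Lh fh]; apply/eqP; rewrite eq_le nrm_ge0 andbT.
have Lff' := L2_lin a Lf Lf'.
pose A := cabs a ^+ 2.
have A0 : 0 <= A by exact: sqr_ge0.
(* The outer 2 joins two errors: that of the approximations to h, g, g', and K times the squared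
   norm of P - (a p + p'). *)
pose M := 2 * (2 * (1 + 2 * (A + 1)) + K * (2 * (1 + 2 * (A + 1)))).
apply: (@le0_small R _ M) => e e0.
have [p [q [pq op _ gq]]] := fg _ e0.
have [p' [q' [pq' op' _ gq']]] := fg' _ e0.
have [P [Q [PQ oP _ hQ]]] := fh _ e0.
have Lp := L2l pq; have Lq := L2r pq; have Lp' := L2l pq'; have Lq' := L2r pq'.
have LP := L2l PQ; have LQ := L2r PQ.
have comb u u' U : L2 w u -> L2 w u' -> L2 w U ->
    nrm u <= e -> nrm u' <= e -> nrm U <= e ->
    nrm (fun t => U t - (a * u t + u' t)) <= 2 * (1 + 2 * (A + 1)) * e.
  move=> Lu Lu' LU nu nu' nU; apply: le_trans (nrmB LU (L2_lin a Lu Lu')) _.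
  have := nrmD (L2Z a Lu) Lu'; rewrite nrmZ// -/A.
  have : A * nrm u <= A * e by exact: ler_wpM2l.
  lra.
have dG := GB PQ (Glin a pq pq').
have o : nearly_orth (2 * (e + 2 * (A * e + e))) (fun t => P t - (a * p t + p' t)).
  have oN d u : L2 w u -> nearly_orth d u -> nearly_orth d (fun t => -1 * u t).
    by move=> Lu /(nearly_orthZ (-1) Lu); rewrite cabs_sqN cabs_sqC expr1n mul1r.
  have LfP := L2B Lff' LP; have Lfp := L2B Lf Lp; have Lfp' := L2B Lf' Lp'.
  have := nearly_orthD (L2Z (-1) LfP) (L2_lin a Lfp Lfp') (oN _ _ LfP oP)
    (nearly_orthD (L2Z a Lfp) Lfp' (nearly_orthZ a Lfp op) op').
  by congr (nearly_orth _ _); apply/funext => t; ring.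
have nd := nearly_orth_nrm _ dG o.
have {}nd : nrm (fun t => P t - (a * p t + p' t)) <= 2 * (e + 2 * (A * e + e)).
  by apply: nd; have := mulr_ge0 A0 (ltW e0); lra.
have nr := Gbound dG.
have -> : (fun t => h t - (a * g t + g' t)) =
    (fun t => ((h t - Q t) - (a * (g t - q t) + (g' t - q' t))) +
              (Q t - (a * q t + q' t))).
  by apply/funext => t; ring.
have Lgq := L2B Lg Lq; have Lgq' := L2B Lg' Lq'; have LhQ := L2B Lh LQ.
apply: le_trans (nrmD (L2B LhQ (L2_lin a Lgq Lgq')) (L2r dG)) _.
have := comb _ _ _ Lgq Lgq' LhQ gq gq' hQ.
have : K * nrm (fun t => P t - (a * p t + p' t)) <= K * (2 * (e + 2 * (A * e + e))).
  exact: ler_wpM2l.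
by rewrite /M; lra.
Qed.

(** Near projections with tolerances 8^-k have consecutive differences in the domain that are nearly
    orthogonal to it, of squared norm at most 2 (8^-k + 8^-(k+1)) <= 4 * 8^-k. Their images
    therefore satisfy the hypothesis of [L2_complete]. *)
Lemma ext_rel_exists f : L2 w f -> exists g, ext_rel f g.
Proof.
move=> Lf; pose e k : R := 8^-1 ^+ k.
have e0 k : 0 < e k by rewrite exprn_gt0// invr_gt0.
have /choice[pq hpq] : forall k, exists r : (R -> R[i]) * (R -> R[i]), [/\ G r.1 r.2,
    nearly_orth (e k) (fun t => f t - r.1 t) & nrm (fun t => f t - r.1 t) <= nrm f + e k].
  by move=> k; have [p [q ?]] := near_projection Lf (e0 k); exists (p, q).
have Gk k : G (pq k).1 (pq k).2 by case: (hpq k).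
have Lk k := L2l (Gk k).
have inc k : nrm (fun t => (pq k.+1).2 t - (pq k).2 t) <= (K * 4) * 8^-1 ^+ k.
  have dG := GB (Gk k.+1) (Gk k).
  apply: le_trans (Gbound dG) _; rewrite -mulrA ler_wpM2l//.
  have [_ o _] := hpq k; have [_ o' _] := hpq k.+1.
  have LB i : L2 w (fun t => f t - (pq i).1 t) by exact: L2B.
  have := nearly_orthD (LB k) (L2Z (-1) (LB k.+1)) o (nearly_orthZ (-1) (LB k.+1) o').
  rewrite cabs_sqN cabs_sqC expr1n mul1r => oo.
  have : nrm (fun t => (pq k.+1).1 t - (pq k).1 t) <= 2 * (e k + e k.+1).
    apply: nearly_orth_nrm dG _; first by rewrite mulr_ge0// addr_ge0// ltW.
    move: oo; congr (nearly_orth _ _).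
    by apply/funext => t; ring.
  move=> /le_trans; apply; have := e0 k; rewrite /e exprS; lra.
have [g Lg gk] := L2_complete (fun k => L2r (Gk k)) inc.
exists g; split=> // d d0.
have [k [ek gkd]] : exists k, e k <= d /\ 4 * (K * 4) * e k <= d.
  have : e k @[k --> \oo] --> 0.
    have -> : e = geometric 1 8^-1 by apply/funext => k; rewrite /= mul1r.
    by apply: cvg_geometric; rewrite ger0_norm ?invr_ge0// invf_lt1 ?ltr1n.
  (* The denominator serves both requirements at once, also when K = 0. *)
  move=> /cvgrPdist_lt/(_ (d / (16 * K + 1))) [].
    by rewrite divr_gt0// ltr_wpDl// mulr_ge0.
  move=> k _ /(_ k (leqnn k)) /=; rewrite sub0r normrN gtr0_norm// => ekd.
  have K1 : 0 < 16 * K + 1 by rewrite ltr_wpDl// mulr_ge0.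
  move: ekd; rewrite ltr_pdivlMr// => ekd; exists k.
  have := e0 k; have := mulr_ge0 (ltW (e0 k)) K_ge0.
  by move=> ? ?; split; nra.
have [Gp o n] := hpq k.
exists (pq k).1, (pq k).2; split=> //.
- move=> p q pq'; apply: le_trans (o _ _ pq') _.
  by rewrite ler_wpM2r ?nrm_ge0.
- by apply: le_trans n _; rewrite lerD2l.
- exact: le_trans (gk k) gkd.
Qed.

(** On the closure of the domain this is the continuous extension; on the orthogonal complement it
    is null. *)
Theorem extension : exists2 T, bounded_op w T & forall p q, G p q -> eqL2 w (T p) q.
Proof.
have /choice[T hT] : forall f, exists g, L2 w f -> ext_rel f g.
  (* Outside [L2 w] the value is arbitrary. *)
  move=> f; have [Lf|nLf] := pselect (L2 w f); last by exists f.
  by have [g fg] := ext_rel_exists Lf; exists g.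
have LT f : L2 w f -> L2 w (T f) by move=> /hT[].
exists T; last first.
  move=> p q pq; have Lp := L2l pq; have := hT _ Lp; rewrite /eqL2 => Tp.
  rewrite nrmE; last exact: L2B (LT _ Lp) (L2r pq).
  have e0 : (fun t => 0 * 0 + p t) = p by apply/funext => t; rewrite mul0r add0r.
  (* Linearity with scalar 0 compares the chosen [T p] with the value [q] prescribed by the
     graph. *)
  have := ext_rel_lin (a := 0) (f := fun=> 0) (f' := p) (h := T p) L2_0 Lp
    (ext_rel_graph G0) (ext_rel_graph pq).
  rewrite e0 => /(_ Tp) z; congr (_%:E); rewrite -[RHS]z; congr nrm.
  by apply/funext => t; rewrite mul0r add0r.
split=> //.
- move=> a f g Lf Lg; have Lfg := L2_lin a Lf Lg.
  rewrite /eqL2 nrmE; last exact: L2B (LT _ Lfg) (L2_lin a (LT _ Lf) (LT _ Lg)).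
  by rewrite (ext_rel_lin Lf Lg (hT _ Lf) (hT _ Lg) (hT _ Lfg)).
exists (Num.sqrt (8 * K)) => f Lf.
rewrite sqr_sqrtr ?mulr_ge0// !nrmE//; last exact: LT.
by rewrite -EFinM lee_fin ext_rel_bound//; exact: hT.
Qed.

End Extension.
End WeightedL2.

(** * Trigonometric polynomials *)

Section TrigPoly.
Variable R : realType.
Implicit Types (s : seq int) (a : int -> R[i]) (f g : R -> R[i]).
Local Notation I := (@circle_dom R).
Local Notation mu := (@lebesgue_measure R).
Let mI := @measurable_circle_dom R.
#[local] Hint Resolve mI : core.

Lemma cexpD (m n : int) (t : R) : cexp (m + n) t = cexp m t * cexp n t.
Proof.
rewrite /cexp intrD mulrDl cosD sinD; apply/eqP; rewrite eq_complex /= eqxx /=.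
by apply/eqP; ring.
Qed.

Lemma cexp0 (t : R) : cexp 0 t = 1.
Proof. by rewrite /cexp mul0r cos0 sin0. Qed.

Lemma conj_cexp n (t : R) : conjc (cexp n t) = cexp (- n) t.
Proof. by rewrite /cexp /= mulrNz mulNr cosN sinN. Qed.

Lemma cabs_sq_cexp n (t : R) : cabs (cexp n t) ^+ 2 = 1.
Proof. by rewrite cabs_sq /= cos2Dsin2. Qed.

Lemma cexp_2pi n : cexp n (2 * pi) = 1 :> R[i].
Proof.
have e1 : cexp 1 (2 * pi) = 1 :> R[i].
  by rewrite /cexp mul1r mulr_natl cos2pi sin2pi.
have en (k : nat) : cexp k%:Z (2 * pi) = 1 :> R[i].
  elim: k => [|k IH]; first exact: cexp0.
  by rewrite -addn1 PoszD cexpD IH e1 mulr1.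
case: n => n; first exact: en.
by rewrite NegzE -conj_cexp en conjc1.
Qed.

Lemma sin_int2pi (n : int) : sin (n%:~R * (2 * pi)) = 0 :> R.
Proof. exact: (congr1 (@complex.Im R) (cexp_2pi n)). Qed.

Lemma cos_int2pi (n : int) : cos (n%:~R * (2 * pi)) = 1 :> R.
Proof. exact: (congr1 (@complex.Re R) (cexp_2pi n)). Qed.

Lemma integral_circle_derive (F f : R -> R) :
  (forall x : R, is_derive x (1 : R) F (f x)) -> continuous f ->
  Rintegral mu I f = F (2 * pi) - F 0.
Proof.
move=> Ff cf; rewrite /Rintegral /circle_dom.
have cF : continuous F.
  move=> x; apply: differentiable_continuous; apply/derivable1_diffP.
  exact: ex_derive.
rewrite (@continuous_FTC2 _ f F)//.
- exact: twopi_gt0.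
- exact: continuous_subspaceT.
- split; first by move=> x _; exact: ex_derive.
  + by apply: cvg_at_right_filter; exact: cF.
  + by apply: cvg_at_left_filter; exact: cF.
- by move=> x _; rewrite derive1E; exact: derive_val.
Qed.

Lemma continuous_cosn (n : int) : continuous (fun t : R => cos (n%:~R * t)).
Proof.
move=> t; apply: continuous_comp; last exact: continuous_cos.
by apply: cvgM; [exact: cvg_cst|exact: cvg_id].
Qed.

Lemma continuous_sinn (n : int) : continuous (fun t : R => sin (n%:~R * t)).
Proof.
move=> t; apply: continuous_comp; last exact: continuous_sin.
by apply: cvgM; [exact: cvg_cst|exact: cvg_id].
Qed.

Lemma is_derive_dilation (F f : R -> R) (c k x : R) :
  (forall y : R, is_derive y (1 : R) F (f y)) ->
  is_derive x (1 : R) (fun t => k * F (c * t)) (k * (c * f (c * x))).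
Proof.
move=> Ff; have dl : is_derive x (1 : R) (fun t : R => c * t) c.
  have := @is_deriveZ R R R (fun t => t) c x 1 1 (is_derive_id x 1).
  by rewrite /GRing.scale /= mulr1.
have h := @is_derive1_comp R F (fun t => c * t) x _ _ (Ff _) dl.
have := @is_deriveZ R R R _ k x 1 _ h.
by rewrite /GRing.scale /= (mulrC c (f _)).
Qed.

Lemma Rintegral_cosn (n : int) :
  Rintegral mu I (fun t => cos (n%:~R * t)) = 2 * pi * (n == 0)%:R.
Proof.
have [->|n0] := eqVneq n 0.
  under eq_Rintegral do rewrite mul0r cos0.
  by rewrite Rintegral_cst// mul1r mulr1 [X in fine X]lebesgue_circle_dom.
have nR : n%:~R != 0 :> R by rewrite intr_eq0.
have d (x : R) : is_derive x (1 : R) (fun t => n%:~R^-1 * sin (n%:~R * t)) (cos (n%:~R * x)).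
  have := @is_derive_dilation _ _ n%:~R n%:~R^-1 x (@is_derive_sin R).
  by rewrite mulrA mulVf// mul1r.
rewrite (integral_circle_derive d); last exact: continuous_cosn.
by rewrite sin_int2pi !mulr0 sin0 mulr0 subr0.
Qed.

Lemma Rintegral_sinn (n : int) : Rintegral mu I (fun t => sin (n%:~R * t)) = 0.
Proof.
have [->|n0] := eqVneq n 0.
  under eq_Rintegral do rewrite mul0r sin0.
  by rewrite Rintegral_cst// mul0r.
have nR : n%:~R != 0 :> R by rewrite intr_eq0.
have d (x : R) : is_derive x (1 : R) (fun t => - n%:~R^-1 * cos (n%:~R * t)) (sin (n%:~R * x)).
  have := @is_derive_dilation _ _ n%:~R (- n%:~R^-1) x (@is_derive_cos R).
  by rewrite mulrA mulNr mulVf// mulNr mul1r opprK.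
rewrite (integral_circle_derive d); last exact: continuous_sinn.
by rewrite cos_int2pi !mulr0 cos0 subrr.
Qed.

(** * Means and orthogonality of the exponentials *)

Definition cmean f : R[i] := (((2 * pi)^-1)%:C * (Rintegral mu I (fun t => complex.Re (f t))
  +i* Rintegral mu I (fun t => complex.Im (f t))))%C.

Definition cintegrable f :=
  L1 (fun t => complex.Re (f t)) /\ L1 (fun t => complex.Im (f t)).

Lemma L1_lin (x y : R) (g h : R -> R) : L1 g -> L1 h -> L1 (fun t => x * g t + y * h t).
Proof.
move=> Lg Lh; have := @integrableD _ _ _ mu I mI _ _
  (@integrableZl _ _ _ mu I mI x _ Lg) (@integrableZl _ _ _ mu I mI y _ Lh).
by apply: eq_integrable => // t _; rewrite /= -!EFinM -EFinD.
Qed.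

Lemma cintegrable_lin (z : R[i]) f g : cintegrable f -> cintegrable g ->
  cintegrable (fun t => z * f t + g t).
Proof.
move=> [f1 f2] [g1 g2]; split.
  under eq_fun do rewrite ReD ReM.
  have := L1_lin 1 1 (L1_lin (complex.Re z) (- complex.Im z) f1 f2) g1.
  by under eq_fun do rewrite !mul1r mulNr.
under eq_fun do rewrite ImD ImM.
have := L1_lin 1 1 (L1_lin (complex.Re z) (complex.Im z) f2 f1) g2.
by under eq_fun do rewrite !mul1r.
Qed.

Lemma Rintegral_lin (x y : R) (g h : R -> R) : L1 g -> L1 h ->
  Rintegral mu I (fun t => x * g t + y * h t) =
  x * Rintegral mu I g + y * Rintegral mu I h.
Proof.
move=> Lg Lh.
have z (k : R) (u : R -> R) : L1 u -> L1 (fun t => k * u t).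
  by move=> Lu; have := L1_lin k 0 Lu Lu; under eq_fun do rewrite mul0r addr0.
rewrite RintegralD//; try exact: z.
by rewrite !RintegralZl.
Qed.

Lemma cmean_lin (z : R[i]) f g : cintegrable f -> cintegrable g ->
  cmean (fun t => z * f t + g t) = z * cmean f + cmean g.
Proof.
move=> [f1 f2] [g1 g2]; rewrite /cmean mulrCA -mulrDr; congr (_ * _).
have -> : Rintegral mu I (fun t => complex.Re (z * f t + g t)) =
    Rintegral mu I (fun t => 1 * (complex.Re z * complex.Re (f t) +
      (- complex.Im z) * complex.Im (f t)) + 1 * complex.Re (g t)).
  by apply: eq_Rintegral => t _; rewrite ReD ReM !mul1r mulNr.
have -> : Rintegral mu I (fun t => complex.Im (z * f t + g t)) =
    Rintegral mu I (fun t => 1 * (complex.Re z * complex.Im (f t) +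
      complex.Im z * complex.Re (f t)) + 1 * complex.Im (g t)).
  by apply: eq_Rintegral => t _; rewrite ImD ImM !mul1r.
rewrite !Rintegral_lin//; try exact: L1_lin.
by case: z => x y; apply/eqP; rewrite eq_complex /=; apply/andP; split; apply/eqP; ring.
Qed.

Lemma cintegrable_cexp n : cintegrable (@cexp R n).
Proof.
split; apply: (@bounded_L1 _ _ 1).
- by apply: measurable_funTS; apply: continuous_measurable_fun; exact: continuous_cosn.
- by move=> t _; rewrite ler_norml cos_geN1 cos_le1.
- by apply: measurable_funTS; apply: continuous_measurable_fun; exact: continuous_sinn.
- by move=> t _; rewrite ler_norml sin_geN1 sin_le1.
Qed.

Lemma cmeasurable_cexp n : cmeasurable (@cexp R n).
Proof.
split; apply: measurable_funTS; apply: continuous_measurable_fun.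
  exact: continuous_cosn.
exact: continuous_sinn.
Qed.

Lemma cmean_cexp n : cmean (@cexp R n) = (n == 0)%:R.
Proof.
rewrite /cmean /cexp /= Rintegral_cosn Rintegral_sinn.
have p0 : 2 * pi != 0 :> R by rewrite gt_eqF// twopi_gt0.
apply/eqP; rewrite eq_complex /=; apply/andP; split; apply/eqP.
  rewrite mul0r subr0 mulrA mulVf// mul1r; by case: eqP.
by rewrite mulr0 mul0r addr0; case: eqP.
Qed.

Lemma cintegrable_sum (J : Type) (r : seq J) (z : J -> R[i]) (F : J -> R -> R[i]) :
  (forall j, cintegrable (F j)) -> cintegrable (fun t => \sum_(j <- r) z j * F j t).
Proof.
move=> iF; elim: r => [|j r IH].
  have := cintegrable_lin (-1) (cintegrable_cexp 0) (cintegrable_cexp 0).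
  by congr cintegrable; apply/funext => t; rewrite big_nil mulN1r addNr.
have := cintegrable_lin (z j) (iF j) IH.
by congr cintegrable; apply/funext => t; rewrite big_cons.
Qed.

Lemma cmean_sum (J : Type) (r : seq J) (z : J -> R[i]) (F : J -> R -> R[i]) :
  (forall j, cintegrable (F j)) ->
  cmean (fun t => \sum_(j <- r) z j * F j t) = \sum_(j <- r) z j * cmean (F j).
Proof.
move=> iF; elim: r => [|j r IH].
  have -> : (fun t => \sum_(j <- [::]) z j * F j t) = (fun t => -1 * cexp 0 t + cexp 0 t).
    by apply/funext => t; rewrite big_nil mulN1r addNr.
  by rewrite cmean_lin ?mulN1r ?addNr ?big_nil//; exact: cintegrable_cexp.
rewrite big_cons -IH -cmean_lin//; last exact: cintegrable_sum.
by congr cmean; apply/funext => t; rewrite big_cons.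
Qed.

(** * Coefficients of a trigonometric polynomial *)

Definition tp s a : R -> R[i] := fun t => \sum_(n <- s) a n * cexp n t.

Lemma cintegrable_tp s a : cintegrable (tp s a).
Proof. by apply: cintegrable_sum => n; exact: cintegrable_cexp. Qed.

Lemma cmeasurable_tp s a : cmeasurable (tp s a).
Proof.
elim: s => [|n s IH].
  by have := @cmeasurable_cst R 0; congr cmeasurable; apply/funext => t; rewrite /tp big_nil.
have := cmeasurable_lin (a n) (cmeasurable_cexp n) IH.
by congr cmeasurable; apply/funext => t; rewrite /tp big_cons.
Qed.

Lemma cmean_tp s a : cmean (tp s a) = \sum_(n <- s) a n * (n == 0)%:R.
Proof.
rewrite cmean_sum => [|n]; last exact: cintegrable_cexp.
by apply: eq_bigr => n _; rewrite cmean_cexp.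
Qed.

Lemma fourier_cmean f k : fourier f k = cmean (fun t => f t * cexp (- k) t).
Proof. by []. Qed.

Lemma tp_mul_cexp s a k : (fun t => tp s a t * cexp k t) =
  tp (map (fun n => n + k) s) (fun n => a (n - k)).
Proof.
apply/funext => t; rewrite /tp big_map mulr_suml; apply: eq_bigr => n _.
by rewrite addrK -mulrA -cexpD.
Qed.

Lemma fourier_tp_sum s a k : fourier (tp s a) k = \sum_(n <- s) a n * (n == k)%:R.
Proof.
rewrite fourier_cmean tp_mul_cexp cmean_tp big_map; apply: eq_bigr => n _.
by rewrite opprK subrK subr_eq0.
Qed.

(** Under this condition [a] is the Fourier sequence of [tp s a]. Otherwise repeated exponents would
    add up, and values of [a] off the list would be invisible to the function. *)
Definition supported s a := uniq s /\ forall n, n \notin s -> a n = 0.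

Lemma fourier_tp s a k : supported s a -> fourier (tp s a) k = a k.
Proof.
move=> [us s0]; rewrite fourier_tp_sum.
have [ks|ks] := boolP (k \in s); last first.
  rewrite s0// big_seq big1// => n ns; case: eqP ks => [<-|]; first by rewrite ns.
  by rewrite mulr0.
rewrite (bigD1_seq k)//= eqxx mulr1 big1 ?addr0// => n /negbTE ->.
by rewrite mulr0.
Qed.

Lemma tp_normalize s a : exists s' a', supported s' a' /\ tp s a = tp s' a'.
Proof.
exists (undup s), (fun n => \sum_(m <- s) a m * (m == n)%:R); split.
  split=> [|n]; first exact: undup_uniq.
  rewrite mem_undup => ns; rewrite big_seq big1// => m ms.
  by case: eqP ns => [<-|]; [rewrite ms|rewrite mulr0].
apply/funext => t; rewrite /tp.
under [RHS]eq_bigr do rewrite mulr_suml.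
rewrite exchange_big /= big_seq [RHS]big_seq; apply: eq_bigr => m ms.
rewrite (bigD1_seq m) ?undup_uniq ?mem_undup//= eqxx mulr1 big1 ?addr0// => n nm.
by rewrite eq_sym (negbTE nm) mulr0 mul0r.
Qed.

Lemma trigpolyP f : trigpoly f <-> exists s a, supported s a /\ f = tp s a.
Proof.
split=> [[s [a fE]]|[s [a [_ ->]]]]; last by exists s, a.
have [s' [a' [sa' e]]] := tp_normalize s a; exists s', a'; split=> //.
by rewrite -e; apply/funext => t; rewrite fE.
Qed.

Lemma big_supported (V : nmodType) s s' (F : int -> V) : uniq s -> uniq s' ->
  (forall n, n \notin s -> F n = 0) -> {subset s <= s'} ->
  \sum_(n <- s) F n = \sum_(n <- s') F n.
Proof.
move=> us us' F0 ss'; have -> : \sum_(n <- s') F n = \sum_(n <- [seq n <- s' | n \in s]) F n.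
  rewrite big_filter [RHS]big_mkcond /=; apply: eq_bigr => n _.
  by case: ifPn => // /F0.
apply: perm_big; apply: uniq_perm => //; first exact: filter_uniq.
move=> n; rewrite mem_filter; case: (boolP (n \in s)) => //= /ss' ->//.
Qed.

Lemma tp_widen s s' a : supported s a -> uniq s' -> {subset s <= s'} ->
  tp s a = tp s' a /\ supported s' a.
Proof.
move=> [us s0] us' ss'; split; last first.
  by split=> // n ns'; apply: s0; apply: contra ns'; exact: ss'.
apply/funext => t; apply: big_supported => // n /s0 ->.
by rewrite mul0r.
Qed.

Lemma common_support s s' :
  exists u : seq int, [/\ uniq u, {subset s <= u} & {subset s' <= u}].
Proof.
exists (undup (s ++ s')); split; first exact: undup_uniq.
- by move=> n ns; rewrite mem_undup mem_cat ns.
- by move=> n ns; rewrite mem_undup mem_cat ns orbT.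
Qed.

Lemma tp_lin (z : R[i]) s a a' t :
  z * tp s a t + tp s a' t = tp s (fun n => z * a n + a' n) t.
Proof.
rewrite /tp mulr_sumr -big_split; apply: eq_bigr => n _ /=.
by rewrite mulrDl mulrA.
Qed.

Lemma supported_lin (z : R[i]) s a a' : supported s a -> supported s a' ->
  supported s (fun n => z * a n + a' n).
Proof.
by move=> [us s0] [_ s0']; split=> // n ns; rewrite s0// s0'// mulr0 addr0.
Qed.

Lemma supported_mul (lam : int -> R[i]) s a : supported s a ->
  supported s (fun n => lam n * a n).
Proof. by move=> [us s0]; split=> // n ns; rewrite s0// mulr0. Qed.

(** Multiplication by e_k - 1 is a difference operator on coefficients. Combined with w = sum c_k
    |e_k - 1|^2 and Parseval it produces the Dirichlet form. *)
Lemma tp_shift (k : int) s a : supported s a -> exists s',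
  supported s' (fun n => a (n - k) - a n) /\
  (fun t => (cexp k t - 1) * tp s a t) = tp s' (fun n => a (n - k) - a n).
Proof.
move=> sa.
have sk : supported (map (fun n => n + k) s) (fun n => a (n - k)).
  split; first by rewrite map_inj_uniq ?sa.1//; exact: addIr.
  move=> n ns; apply: sa.2; apply: contra ns => ns.
  by apply/mapP; exists (n - k) => //; rewrite subrK.
have [u [uu us uk]] := common_support s (map (fun n => n + k) s).
have [e ua] := tp_widen sa uu us; have [e' ua'] := tp_widen sk uu uk.
exists u; have su := supported_lin (-1) ua ua'; split.
  by move: su; congr supported; apply/funext => n; rewrite mulN1r addrC.
apply/funext => t; rewrite mulrBl mul1r.
have -> : cexp k t * tp s a t = tp (map (fun n => n + k) s) (fun n => a (n - k)) t.
  by rewrite mulrC -tp_mul_cexp.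
rewrite e e' addrC -mulN1r tp_lin; congr (tp _ _ t).
by apply/funext => n; rewrite mulN1r addrC.
Qed.

(** Only the conjugate factor of |f|^2 is expanded; the mean of each resulting term is conj(a_m)
    times the m-th Fourier coefficient of f, which is a_m. *)
Lemma parseval_tp s a : supported s a ->
  circle_int (fun t => cabs (tp s a t) ^+ 2) = (\sum_(n <- s) cabs (a n) ^+ 2)%:E.
Proof.
move=> sa; pose f := tp s a.
have fE t : cabs (f t) ^+ 2 = complex.Re (conjc (f t) * f t).
  by rewrite cabs_sq ReM; case: (f t) => x y /=; ring.
pose h : R -> R[i] := fun t => \sum_(m <- s) conjc (a m) * (f t * cexp (- m) t).
have ih m : cintegrable (fun t => f t * cexp (- m) t).
  by rewrite tp_mul_cexp; exact: cintegrable_tp.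
have hE t : complex.Re (h t) = cabs (f t) ^+ 2.
  rewrite fE [X in conjc X]/f /tp rmorph_sum /= mulr_suml; congr complex.Re.
  apply: eq_bigr => n _; rewrite rmorphM -conj_cexp -mulrA; congr (_ * _).
  by rewrite mulrC.
have hint : cintegrable h by exact: cintegrable_sum.
rewrite -[LHS]fineK; last first.
  rewrite ge0_fin_numE; last by apply: circle_int_ge0 => t _; exact: sqr_ge0.
  apply/L1P; first exact: measurable_cabs_sq (cmeasurable_tp _ _).
    by move=> t _; exact: sqr_ge0.
  by have := hint.1; congr L1; apply/funext => t; rewrite hE.
congr (_%:E); rewrite fine_circle_int.
under eq_Rintegral do rewrite -hE.
have -> : (2 * pi)^-1 * Rintegral mu I (fun t => complex.Re (h t)) = complex.Re (cmean h).
  by rewrite /cmean ReM /= mul0r subr0.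
rewrite cmean_sum// (big_morph (@complex.Re R) (@ReD R) erefl); apply: eq_bigr => m _.
rewrite -fourier_cmean fourier_tp// cabs_sq.
by case: (a m) => x y /=; ring.
Qed.

End TrigPoly.

(** * Unordered sums *)

Section Esum.
Variable R : realType.
Local Open Scope ereal_scope.

Lemma subset_esum (T : choiceType) (A B : set T) (F : T -> \bar R) :
  A `<=` B -> \esum_(i in A) F i <= \esum_(i in B) F i.
Proof.
move=> AB; apply: ge_ereal_sup => _ [X [finX XA] <-]; apply: ereal_sup_ubound.
by exists X => //; split=> //; exact: subset_trans AB.
Qed.

Lemma esum_ge1 (T : choiceType) (F : T -> \bar R) (x : T) :
  0 <= F x -> F x <= \esum_(i in [set: T]) F i.
Proof. by move=> Fx; rewrite -(esum_set1 Fx); exact: subset_esum. Qed.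

(** Scaling finite partial sums gives one inequality; the other is the same inequality for the
    factor 1/r. *)
Lemma esumZl (T : choiceType) (r : R) (F : T -> \bar R) :
  (0 <= r)%R -> (forall i, 0 <= F i) ->
  r%:E * (\esum_(i in [set: T]) F i) = \esum_(i in [set: T]) (r%:E * F i).
Proof.
move=> r0 F0; have [->|rn0] := eqVneq r 0%R.
  by rewrite mul0e esum1// => i _; rewrite mul0e.
have rpos : (0 < r)%R by rewrite lt_neqAle eq_sym rn0.
have le (k : R) (H : T -> \bar R) : (0 <= k)%R -> (forall i, 0 <= H i) ->
    \esum_(i in [set: T]) (k%:E * H i) <= k%:E * (\esum_(i in [set: T]) H i).
  move=> k0 H0; apply: ge_ereal_sup => _ [X [finX XA] <-].
  rewrite -ge0_mule_fsumr// lee_wpmul2l//.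
  by apply: ereal_sup_ubound; exists X.
apply/eqP; rewrite eq_le le// andbT.
rewrite -(@lee_pmul2l _ r^-1%:E) ?lte_fin ?invr_gt0//.
rewrite muleA -EFinM mulVf// mul1e.
have rF0 i : 0 <= r%:E * F i by rewrite mule_ge0.
apply: le_trans (le _ _ _ rF0); last by rewrite invr_ge0.
by apply: le_esum => i _; rewrite muleA -EFinM mulVf// mul1e.
Qed.

Lemma exchange_esum (T U : choiceType) (F : T -> U -> \bar R) :
  (forall i j, 0 <= F i j) ->
  \esum_(i in [set: T]) \esum_(j in [set: U]) F i j =
  \esum_(j in [set: U]) \esum_(i in [set: T]) F i j.
Proof.
move=> F0; rewrite !esum_esum//.
rewrite (@reindex_esum _ _ _ ([set: U] `*`` (fun=> [set: T])) _ (fun x => (x.2, x.1)))//.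
split=> //; first by move=> [? ?] [? ?] _ _ /= [-> ->].
by move=> [i j] _; exists (j, i).
Qed.

Lemma esum_int_shift (F : int -> \bar R) (m : int) :
  \esum_(n in [set: int]) F (n + m)%R = \esum_(n in [set: int]) F n.
Proof.
rewrite [RHS](@reindex_esum _ _ _ [set: int] _ (fun n => n + m)%R)//.
split=> //; first by move=> x y _ _; exact: addIr.
by move=> y _ /=; exists (y - m)%R; rewrite ?subrK.
Qed.

Lemma esum_nat_le_int (F : int -> \bar R) (h : nat -> int) : injective h ->
  \esum_(k in [set: nat]) F (h k) <= \esum_(n in [set: int]) F n.
Proof.
move=> hinj; rewrite -(@esum_image _ _ _ [set: nat] h); last by move=> x y _ _; exact: hinj.
exact: subset_esum.
Qed.

(** The point m lies on both half-lines, hence an inequality. *)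
Lemma esum_int_le (F : int -> \bar R) (m : int) : (forall n, 0 <= F n) ->
  \esum_(n in [set: int]) F n <=
  \esum_(k in [set: nat]) F (m - k%:Z)%R + \esum_(k in [set: nat]) F (m + k%:Z)%R.
Proof.
move=> F0; rewrite -(@esum_image _ _ _ [set: nat] (fun k => m - k%:Z)%R); last first.
  by move=> x y _ _ /addrI/oppr_inj[].
rewrite -(@esum_image _ _ _ [set: nat] (fun k => m + k%:Z)%R); last first.
  by move=> x y _ _ /addrI[].
rewrite (esumID [set n : int | (n <= m)%R])//.
apply: leeD; apply: subset_esum => n [_ /=].
  move=> nm; exists `|m - n|%N => //=.
  by rewrite gez0_abs ?subr_ge0// subKr.
move/negP; rewrite -ltNge => nm; exists `|n - m|%N => //=.
by rewrite gez0_abs ?subr_ge0 ?ltW// addrCA subrr addr0.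
Qed.

Lemma esum_seq (s : seq int) (F : int -> R) : uniq s -> (forall n, (0 <= F n)%R) ->
  (forall n, n \notin s -> F n = 0%R) ->
  \esum_(n in [set: int]) (F n)%:E = (\sum_(n <- s) F n)%:E.
Proof.
move=> us F0 Fs; rewrite -sumEFin fsbig_seq// -esum_fset//; last first.
  by move=> n _; rewrite lee_fin.
rewrite [RHS]esum_mkcond; apply: eq_esum => n _.
by case: ifPn => //; rewrite notin_setE /= => /negP /Fs ->.
Qed.

End Esum.

(** * The weight, the Dirichlet form and the multiplier criterion *)

Section LKS.
Variables (R : realType) (c : nat -> R).
Implicit Types (s : seq int) (a lam : int -> R[i]) (f g : R -> R[i]).
Local Notation I := (@circle_dom R).
Local Notation mu := (@lebesgue_measure R).
Let mI := @measurable_circle_dom R.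
#[local] Hint Resolve mI : core.

Hypothesis hc0 : c 0%N = 0.
Hypothesis hc : forall k : nat, (1 <= k)%N -> 0 <= c k.
Hypothesis hcsum : (0 < \sum_(1 <= k <oo) (c k)%:E < +oo)%E.

Local Notation w := (LKS_weight c).

Lemma coef_ge0 k : 0 <= c k.
Proof. by case: k => [|k]; [rewrite hc0|exact: hc]. Qed.

Lemma nneseries_from1 (F : nat -> \bar R) : (forall k, 0 <= F k)%E -> F 0%N = 0%E ->
  (\sum_(1 <= k <oo) F k = \sum_(0 <= k <oo) F k)%E.
Proof.
move=> F0 F00; rewrite (@nneseries_split _ F 0 1); last by move=> k _.
by rewrite big_nat1 F00 add0e.
Qed.

Definition coef_sum : R := fine (\sum_(0 <= k <oo) (c k)%:E)%E.

Lemma coef_sumE : (\sum_(0 <= k <oo) (c k)%:E = coef_sum%:E)%E.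
Proof.
rewrite /coef_sum fineK// -nneseries_from1 ?hc0//; last by move=> k; rewrite lee_fin coef_ge0.
by case/andP: hcsum => h1 h2; rewrite ge0_fin_numE// ltW.
Qed.

Lemma coef_sum_gt0 : 0 < coef_sum.
Proof.
rewrite -lte_fin -coef_sumE -nneseries_from1 ?hc0//; first by case/andP: hcsum.
by move=> k; rewrite lee_fin coef_ge0.
Qed.

Lemma exists_coef_gt0 : exists2 k, (1 <= k)%N & 0 < c k.
Proof.
apply: contrapT => nk; have := coef_sum_gt0; rewrite -lte_fin -coef_sumE eseries0 ?ltxx//.
move=> k _ _; congr (_%:E); apply/eqP; rewrite eq_le coef_ge0 andbT leNgt.
apply/negP => ck; apply: nk; exists k => //.
by case: k ck => //; rewrite hc0 ltxx.
Qed.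

Let term (k : nat) (t : R) := c k * sin (k%:R * t / 2) ^+ 2.

Lemma term_ge0 k t : 0 <= term k t.
Proof. by rewrite mulr_ge0 ?coef_ge0 ?sqr_ge0. Qed.

Lemma term_le k t : term k t <= c k.
Proof.
by rewrite /term ler_piMr ?coef_ge0.
Qed.

(** The real limit in the weight is a true sum because its terms are dominated by the summable c_k.
    In extended reals, sums and integrals of the nonnegative terms can then be exchanged freely. *)
Lemma LKS_weight_series t : ((w t)%:E = \sum_(0 <= k <oo) (4 * term k t)%:E)%E.
Proof.
have t0 k : (0 <= (term k t)%:E)%E by rewrite lee_fin term_ge0.
under eq_eseriesr do rewrite EFinM.
rewrite nneseriesZl// summable_nneseries_lim//; last first.
  rewrite /summable; under eq_esum do rewrite gee0_abs//.
  rewrite -(@nneseries_esum _ (fun k => (term k t)%:E) xpredT)//.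
  apply: le_lt_trans (ltry coef_sum); rewrite -coef_sumE.
  by apply: lee_nneseries => // k _; rewrite lee_fin term_le.
rewrite -EFinM; congr ((_ * _)%:E); congr (limn _); apply/funext => -[|n].
  by rewrite !big_nil.
rewrite [RHS]big_nat_recl// [X in X + _]/= /term hc0 mul0r add0r.
by rewrite big_add1.
Qed.

Lemma LKS_weight_ge0 t : 0 <= w t.
Proof.
rewrite -lee_fin LKS_weight_series; apply: nneseries_ge0 => k _ _.
by rewrite lee_fin mulr_ge0// term_ge0.
Qed.

Lemma LKS_weight_le t : w t <= 4 * coef_sum.
Proof.
rewrite -lee_fin LKS_weight_series EFinM -coef_sumE -nneseriesZl; last first.
  by move=> k _; rewrite lee_fin coef_ge0.
apply: lee_nneseries => k _; first by rewrite lee_fin mulr_ge0// term_ge0.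
by rewrite -EFinM lee_fin ler_wpM2l// term_le.
Qed.

Lemma LKS_weight_ge_term k t : 4 * term k t <= w t.
Proof.
rewrite -lee_fin LKS_weight_series nneseries_esumT; last first.
  by move=> j; rewrite lee_fin mulr_ge0// term_ge0.
by apply: (@esum_ge1 _ _ (fun k => (4 * term k t)%:E)); rewrite lee_fin mulr_ge0// term_ge0.
Qed.

Lemma termE k t : 4 * term k t = c k * cabs (cexp k%:Z t - 1) ^+ 2.
Proof.
rewrite /term mulrCA; congr (_ * _); rewrite cabs_sq /cexp /= oppr0 addr0.
rewrite -[k%:~R]/(k%:R : R).
rewrite [in RHS](_ : k%:R * t = k%:R * t / 2 + k%:R * t / 2); last by field.
set x := k%:R * t / 2; rewrite cosD sinD.
(* The constant 1 is written cos^2 + sin^2, which makes both sides homogeneous of degree four and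
   the identity purely polynomial. *)
have e : 4 * sin x ^+ 2 * (cos x ^+ 2 + sin x ^+ 2) =
    (cos x * cos x - sin x * sin x - (cos x ^+ 2 + sin x ^+ 2)) ^+ 2 +
    (sin x * cos x + cos x * sin x) ^+ 2 by ring.
by move: e; rewrite cos2Dsin2 mulr1.
Qed.

Lemma measurable_LKS_weight : measurable_fun I w.
Proof.
apply/measurable_EFinP; rewrite /comp; under eq_fun do rewrite /= LKS_weight_series.
apply: ge0_emeasurable_sum => [k t _ _|k _].
  by rewrite lee_fin mulr_ge0// term_ge0.
apply/measurable_EFinP; under eq_fun do rewrite termE.
apply: measurable_funM => //; apply: measurable_cabs_sq.
have := cmeasurable_lin 1 (@cmeasurable_cexp R k%:Z) (@cmeasurable_cst R (-1)).
by under eq_fun do rewrite mul1r.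
Qed.

(** Termwise integration of |f|^2 times the series of the weight; the k-th term is c_k |(e_k - 1)
    f|^2. *)
Lemma normsq_LKS f : cmeasurable f -> (normsq w f =
  \sum_(0 <= k <oo) (c k)%:E * circle_int (fun t => cabs ((cexp k%:Z t - 1) * f t) ^+ 2)%R)%E.
Proof.
move=> mf; rewrite /normsq {1}/circle_int.
have md k : measurable_fun I (fun t => cabs ((cexp k%:Z t - 1) * f t) ^+ 2).
  apply: measurable_cabs_sq; apply: cmeasurableM => //.
  have := cmeasurable_lin 1 (@cmeasurable_cexp R k%:Z) (@cmeasurable_cst R (-1)).
  by under eq_fun do rewrite mul1r.
have dE t : (cabs (f t) ^+ 2 * w t)%:E =
    (\sum_(0 <= k <oo) (c k * cabs ((cexp k%:Z t - 1) * f t) ^+ 2)%R%:E)%E.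
  rewrite EFinM LKS_weight_series -nneseriesZl; last first.
    by move=> k _; rewrite lee_fin mulr_ge0// term_ge0.
  apply: eq_eseriesr => k _; rewrite -EFinM termE cabs_sqM; congr (_%:E); ring.
under eq_integral do rewrite dE.
have ck0 k t : 0 <= c k * cabs ((cexp k%:Z t - 1) * f t) ^+ 2.
  by rewrite mulr_ge0 ?coef_ge0 ?sqr_ge0.
rewrite integral_nneseries//; last 2 first.
- by move=> k; apply/measurable_EFinP; apply: measurable_funM; [exact: measurable_cst|exact: md].
- by move=> k t _; rewrite lee_fin.
rewrite -nneseriesZl; last first.
  by move=> k _; apply: integral_ge0 => t _; rewrite lee_fin.
apply: eq_eseriesr => k _; rewrite -circle_intZl ?coef_ge0//.
by move=> t _; exact: sqr_ge0.
Qed.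

(** * The Dirichlet form of a coefficient sequence *)

Definition energy a : \bar R := \esum_(k in [set: nat]) \esum_(n in [set: int])
  (c k * cabs (a (n - k%:Z) - a n) ^+ 2)%:E.

Lemma normsq_tp s a : supported s a -> normsq w (tp s a) = energy a.
Proof.
move=> sa; rewrite normsq_LKS; last exact: cmeasurable_tp.
rewrite nneseries_esumT; last first.
  move=> k; rewrite mule_ge0 ?lee_fin ?coef_ge0//.
  by apply: circle_int_ge0 => t _; exact: sqr_ge0.
apply: eq_esum => k _; have [s' [sa' e]] := tp_shift k%:Z sa.
have -> : (fun t => cabs ((cexp k%:Z t - 1) * tp s a t) ^+ 2) =
    (fun t => cabs (tp s' (fun n => a (n - k%:Z) - a n) t) ^+ 2).
  by apply/funext => t; rewrite -e.
rewrite parseval_tp// -EFinM mulr_sumr; apply/esym/esum_seq; first exact: sa'.1.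
  by move=> n; rewrite mulr_ge0 ?coef_ge0 ?sqr_ge0.
by move=> n /sa'.2 ->; rewrite cabs0 expr0n mulr0.
Qed.

(** The weight is bounded by 4 sum c_k, so Parseval suffices. *)
Lemma L2_tp s a : L2 w (tp s a).
Proof.
apply/L2P; split; first exact: cmeasurable_tp.
have [s' [a' [sa' ->]]] := tp_normalize s a.
have mf := @cmeasurable_tp R s' a'.
apply: (@le_lt_trans _ _ ((4 * coef_sum)%:E * circle_int (fun t => cabs (tp s' a' t) ^+ 2)%R)%E).
  rewrite -circle_intZl; last 3 first.
  - exact: measurable_cabs_sq.
  - by move=> t _; exact: sqr_ge0.
  - by rewrite mulr_ge0// ltW// coef_sum_gt0.
  apply: le_circle_int.
  - exact (measurable_density measurable_LKS_weight mf).
  - by apply: measurable_funM => //; exact: measurable_cabs_sq.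
  move=> t _; rewrite mulr_ge0 ?sqr_ge0 ?LKS_weight_ge0//= mulrC.
  by rewrite ler_wpM2r ?sqr_ge0// LKS_weight_le.
by rewrite parseval_tp// -EFinM ltry.
Qed.

Let w0 := LKS_weight_ge0.
Let mw := measurable_LKS_weight.
Local Notation nw := (nrm w).

(** A relation between functions, since lambda acts on coefficients, which a polynomial given as a
    function does not carry along. *)
Definition multiplier_graph lam (p q : R -> R[i]) := exists s a,
  [/\ supported s a, p = tp s a & q = tp s (fun n => lam n * a n)].

Lemma supported1 n : supported [:: n] (fun m => (m == n)%:R : R[i]).
Proof. by split=> // m; rewrite inE => /negbTE ->. Qed.

Lemma cexp_tp n : @cexp R n = tp [:: n] (fun m => (m == n)%:R).
Proof. by apply/funext => t; rewrite /tp big_seq1 eqxx mul1r. Qed.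

Lemma mult_of_bound lam K : 0 <= K ->
  (forall s a, supported s a -> nw (tp s (fun n => lam n * a n)) <= K * nw (tp s a)) ->
  Mult w lam.
Proof.
move=> K0 bd.
have [|||||T bT Tg] := @extension R w w0 mw (multiplier_graph lam) K.
- by move=> p q [s [a [_ -> ->]]]; split; exact: L2_tp.
- by exists [::], (fun=> 0); split=> //; apply/funext => t; rewrite /tp big_nil.
- move=> z p q p' q' [s [a [sa -> ->]]] [s' [a' [sa' -> ->]]].
  have [u [uu us us']] := common_support s s'.
  have [e ua] := tp_widen sa uu us; have [e' ua'] := tp_widen sa' uu us'.
  exists u, (fun n => z * a n + a' n); split; first exact: supported_lin.
    by apply/funext => t; rewrite e e' tp_lin.
  have [-> _] := tp_widen (supported_mul lam sa) uu us.
  have [-> _] := tp_widen (supported_mul lam sa') uu us'.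
  apply/funext => t; rewrite tp_lin; congr (tp _ _ t); apply/funext => n; ring.
- exact: K0.
- by move=> p q [s [a [sa -> ->]]]; exact: bd.
exists T => // n; apply: Tg; exists [:: n], (fun m => (m == n)%:R); split.
- exact: supported1.
- exact: cexp_tp.
- by apply/funext => t; rewrite /tp big_seq1 eqxx mulr1.
Qed.

(** [T] is linear, and agrees with lambda on exponentials, only up to null functions. Agreement on
    polynomials is therefore an induction on the list of exponents in which every error has norm
    0. *)
Lemma bound_of_mult lam : Mult w lam -> exists2 K, 0 <= K &
  forall s a, nw (tp s (fun n => lam n * a n)) <= K * nw (tp s a).
Proof.
move=> [T [LT Tlin [M TM]] Tlam].
have nM f : L2 w f -> nw (T f) <= M ^+ 2 * nw f.
  move=> Lf; have LTf := LT _ Lf; have := TM _ Lf.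
  by rewrite !nrmE// -EFinM lee_fin.
have eqL2_nrm f g : L2 w f -> L2 w g -> eqL2 w f g -> nw (fun t => f t - g t) = 0.
  by move=> Lf Lg; rewrite /eqL2 (nrmE w0 (L2B w0 mw Lf Lg)) => -[].
have agree s a : nw (fun t => T (tp s a) t - tp s (fun n => lam n * a n) t) = 0.
  elim: s => [|n s IH]; apply/eqP; rewrite eq_le nrm_ge0// andbT.
    have -> : tp [::] a = fun=> 0 by apply/funext => t; rewrite /tp big_nil.
    have -> : tp [::] (fun n => lam n * a n) = fun=> 0.
      by apply/funext => t; rewrite /tp big_nil.
    under [X in nw X]eq_fun do rewrite subr0.
    apply: le_trans (nM _ (L2_0 _)) _.
    by rewrite nrm0 mulr0.
  have e b : tp (n :: s) b = (fun t => b n * cexp n t + tp s b t).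
    by apply/funext => t; rewrite /tp big_cons.
  pose f := @cexp R n; pose g := tp s a; pose g' := tp s (fun n => lam n * a n).
  have Lf : L2 w f by rewrite /f cexp_tp; exact: L2_tp.
  have Lg : L2 w g by exact: L2_tp.
  have Lg' : L2 w g' by exact: L2_tp.
  have Lh := L2_lin w0 mw (a n) Lf Lg.
  have LTh := LT _ Lh; have LTf := LT _ Lf; have LTg := LT _ Lg.
  have L1 := L2B w0 mw LTh (L2_lin w0 mw (a n) LTf LTg).
  have n1 := eqL2_nrm _ _ LTh (L2_lin w0 mw (a n) LTf LTg) (Tlin (a n) _ _ Lf Lg).
  have L2' := L2B w0 mw LTf (L2Z w0 mw (lam n) Lf).
  have n2 := eqL2_nrm _ _ LTf (L2Z w0 mw (lam n) Lf) (Tlam n).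
  have L3 := L2B w0 mw LTg Lg'.
  have n4 := nrmD w0 mw L1 (L2_lin w0 mw (a n) L2' L3).
  have n3 := nrmD w0 mw (L2Z w0 mw (a n) L2') L3.
  rewrite nrmZ// n2 IH mulr0 addr0 mulr0 in n3; rewrite n1 add0r in n4.
  have : 2 * nw (fun t => a n * (T f t - lam n * f t) + (T g t - g' t)) <= 0.
    by rewrite pmulr_rle0.
  move=> /(le_trans n4); congr (nw _ <= _); apply/funext => t.
  by rewrite !e /f /g /g'; ring.
exists (2 * M ^+ 2) => [|s a]; first by rewrite mulr_ge0 ?sqr_ge0.
have Lf := L2_tp s a; have Lg := L2_tp s (fun n => lam n * a n); have LTf := LT _ Lf.
(* The image is written as T f - (T f - image) with a null second term; this costs the factor 2. *)
have := nrmB w0 mw LTf (L2B w0 mw LTf Lg); rewrite agree addr0.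
under [X in nw X <= _]eq_fun do rewrite subKr.
by move=> /le_trans; apply; rewrite -mulrA ler_wpM2l// nM.
Qed.

(** * The Dirichlet form compared with the sums mu_k^2 *)

Lemma musq_ge0 lam k : (0 <= musq c lam k)%E.
Proof. by apply: esum_ge0 => j _; rewrite lee_fin mulr_ge0 ?coef_ge0 ?sqr_ge0. Qed.

(** In the form each n meets only the indices n - k with k >= 0, so the terms with lam (n - k) - lam
    n make up at most the full sum mu_n^2. *)
Lemma energy_mul_le lam a (M : R) : (forall n, cabs (lam n) ^+ 2 <= M) ->
  (energy (fun n => lam n * a n)%R <=
   (2 * M)%:E * energy a +
   2%:E * (\esum_(n in [set: int]) (cabs (a n) ^+ 2)%:E * musq c lam n))%E.
Proof.
move=> lamM.
have M0 : 0 <= M by exact: le_trans (sqr_ge0 _) (lamM 0).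
pose u k n := c k * cabs (a (n - k%:Z) - a n) ^+ 2.
pose v k n := cabs (a n) ^+ 2 * (c k * cabs (lam (n - k%:Z) - lam n) ^+ 2).
have u0 k n : 0 <= u k n by rewrite mulr_ge0 ?coef_ge0 ?sqr_ge0.
have v0 k n : 0 <= v k n by rewrite mulr_ge0 ?sqr_ge0// mulr_ge0 ?coef_ge0 ?sqr_ge0.
have -> : energy a = \esum_(k in [set: nat]) \esum_(n in [set: int]) (u k n)%:E by [].
apply: (@le_trans _ _ ((2 * M)%:E * (\esum_(k in [set: nat]) \esum_(n in [set: int]) (u k n)%:E) +
    2%:E * (\esum_(k in [set: nat]) \esum_(n in [set: int]) (v k n)%:E)))%E.
  have ue k : (0 <= \esum_(n in [set: int]) (u k n)%:E)%E.
    by apply: esum_ge0 => n _; rewrite lee_fin.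
  have ve k : (0 <= \esum_(n in [set: int]) (v k n)%:E)%E.
    by apply: esum_ge0 => n _; rewrite lee_fin.
  have M20 : 0 <= 2 * M by rewrite mulr_ge0.
  rewrite !esumZl// -esumD; last 2 first.
    by move=> k _; rewrite mule_ge0.
    by move=> k _; rewrite mule_ge0.
  apply: le_esum => k _; rewrite !esumZl//; try by move=> n; rewrite lee_fin.
  rewrite -esumD; last 2 first.
    by move=> n _; rewrite -EFinM lee_fin mulr_ge0.
    by move=> n _; rewrite -EFinM lee_fin mulr_ge0.
  apply: le_esum => n _; rewrite -!EFinM -EFinD lee_fin /u /v.
  have -> : lam (n - k%:Z) * a (n - k%:Z) - lam n * a n =
    lam (n - k%:Z) * (a (n - k%:Z) - a n) + a n * (lam (n - k%:Z) - lam n) by ring.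
  apply: le_trans (ler_wpM2l (coef_ge0 k) (cabs_sqD _ _)) _; rewrite !cabs_sqM.
  have := lamM (n - k%:Z); have := coef_ge0 k.
  move: (cabs (lam (n - _)) ^+ 2) (sqr_ge0 (cabs (a (n - k%:Z) - a n))) => L.
  move: (cabs (a (n - k%:Z) - a n) ^+ 2) => x x0 ck LM.
  have : 2 * c k * x * L <= 2 * c k * x * M by rewrite ler_wpM2l ?mulr_ge0.
  by lra.
rewrite leeD2l// lee_wpmul2l// exchange_esum; last by move=> i j; rewrite lee_fin.
apply: le_esum => n _.
rewrite /musq esumZl ?sqr_ge0//; last by move=> j; rewrite lee_fin mulr_ge0 ?coef_ge0 ?sqr_ge0.
rewrite [leLHS](_ : _ = \esum_(k in [set: nat]) (fun j : int =>
    (cabs (a n) ^+ 2)%:E * (c `|n - j|%N * cabs (lam j - lam n) ^+ 2)%:E)%E (n - k%:Z)).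
  by apply: esum_nat_le_int => x y /addrI/oppr_inj[].
by apply: eq_esum => k _; rewrite -EFinM subKr.
Qed.
(** Translating n by k reverses the direction of the differences, so the other half-line carries the
    same energy. *)
Lemma energy_addn a : energy a = \esum_(k in [set: nat]) \esum_(n in [set: int])
  (c k * cabs (a (n + k%:Z) - a n) ^+ 2)%:E.
Proof.
apply: eq_esum => k _; rewrite -[LHS](@esum_int_shift _ _ k%:Z).
by apply: eq_esum => n _; rewrite addrK -[in RHS]cabs_sqN opprB.
Qed.

(** With b = lam a, one has a_n (lam_m - lam_n) = (b_m - b_n) - lam_m (a_m - a_n). The sum over m
    runs over two half-lines, each costing 2 energies of b and 2 M energies of a. *)
Lemma musq_sum_le lam a (M : R) : (forall n, cabs (lam n) ^+ 2 <= M) ->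
  (\esum_(n in [set: int]) ((cabs (a n) ^+ 2)%:E * musq c lam n) <=
   4%:E * energy (fun n => lam n * a n)%R + (4 * M)%:E * energy a)%E.
Proof.
move=> lamM; set b := fun n => lam n * a n.
have M0 : 0 <= M by exact: le_trans (sqr_ge0 _) (lamM 0).
pose F n j := (cabs (a n) ^+ 2 * (c `|n - j|%N * cabs (lam j - lam n) ^+ 2))%:E.
have F0 n j : (0 <= F n j)%E.
  by rewrite lee_fin mulr_ge0 ?sqr_ge0// mulr_ge0 ?coef_ge0 ?sqr_ge0.
have Q0 (u : int -> R[i]) k m n : (0 <= (c k * cabs (u m - u n) ^+ 2)%:E)%E.
  by rewrite lee_fin mulr_ge0 ?coef_ge0 ?sqr_ge0.
(* The map [h] stands for n - k or n + k; only |n - h n k| = k is needed. *)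
have half (h : int -> nat -> int) : (forall n k, `|n - h n k|%N = k) ->
   (\esum_(n in [set: int]) \esum_(k in [set: nat]) F n (h n k) <=
    2%:E * (\esum_(k in [set: nat]) \esum_(n in [set: int])
       (c k * cabs (b (h n k) - b n) ^+ 2)%:E) +
    (2 * M)%:E * (\esum_(k in [set: nat]) \esum_(n in [set: int])
       (c k * cabs (a (h n k) - a n) ^+ 2)%:E))%E.
  move=> hk; rewrite exchange_esum//.
  have E0 (u : int -> R[i]) k :
    (0 <= \esum_(n in [set: int]) (c k * cabs (u (h n k) - u n) ^+ 2)%:E)%E.
    by apply: esum_ge0 => n _.
  have M20 : 0 <= 2 * M by rewrite mulr_ge0.
  rewrite !esumZl// -esumD; last 2 first.
    by move=> k _; rewrite mule_ge0// E0.
    by move=> k _; rewrite mule_ge0// E0.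
  apply: le_esum => k _; rewrite !esumZl// -esumD; last 2 first.
    by move=> n _; rewrite mule_ge0// Q0.
    by move=> n _; rewrite mule_ge0// Q0.
  apply: le_esum => n _; rewrite /F hk -!EFinM -EFinD lee_fin.
  move: (h n k) => m.
  have e : a n * (lam m - lam n) = (b m - b n) - lam m * (a m - a n) by rewrite /b; ring.
  have := cabs_sqB (b m - b n) (lam m * (a m - a n)); rewrite -e !cabs_sqM => le1.
  have ck := coef_ge0 k; have := ler_wpM2l ck le1.
  have : c k * (cabs (lam m) ^+ 2 * cabs (a m - a n) ^+ 2) <=
         c k * (M * cabs (a m - a n) ^+ 2).
    by rewrite ler_wpM2l// ler_wpM2r ?sqr_ge0.
  by lra.
have h1 := half (fun n k => n - k%:Z); have h2 := half (fun n k => n + k%:Z).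
apply: (@le_trans _ _ (\esum_(n in [set: int]) (\esum_(k in [set: nat]) F n (n - k%:Z)%R +
  \esum_(k in [set: nat]) F n (n + k%:Z)%R)))%E.
  apply: le_esum => n _; rewrite /musq esumZl ?sqr_ge0//.
  apply: le_trans (esum_int_le n (F0 n)).
  by apply: le_esum => j _; rewrite -EFinM.
rewrite esumD; last 2 first.
  by move=> n _; exact: esum_ge0.
  by move=> n _; exact: esum_ge0.
have {}h1 := h1 (fun n k => congr1 absz (subKr n k%:Z)).
have {}h2 : (\esum_(n in [set: int]) \esum_(k in [set: nat]) F n (n + k%:Z)%R <=
    2%:E * energy b + (2 * M)%:E * energy a)%E.
  rewrite (energy_addn b) (energy_addn a); apply: h2 => n k.
  by rewrite opprD addrA subrr add0r abszN.
apply: le_trans (leeD h1 h2) _; rewrite -/(energy b) -/(energy a).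
have E0 u : (0 <= energy u)%E by apply: esum_ge0 => k _; exact: esum_ge0.
rewrite addeACA -!ge0_muleDl ?lee_fin ?mulr_ge0// -!EFinD.
by rewrite le_eqVlt; apply/orP; left; apply/eqP; congr (_%:E * _ + _%:E * _)%E; ring.
Qed.

Lemma energy_nrm s a : supported s a -> energy a = (nw (tp s a))%:E.
Proof. by move=> sa; rewrite -(normsq_tp sa) (nrmE w0 (L2_tp s a)). Qed.

(** One term of the energy suffices: a lag k with c_k > 0 at the index n. It allows division by the
    norm of e_n, whence the boundedness of a multiplier. *)
Lemma nrm_cexp_gt0 n : 0 < nw (@cexp R n).
Proof.
have [k k1 ck] := exists_coef_gt0.
rewrite cexp_tp -lte_fin -energy_nrm; last exact: supported1.
have F0 j m : (0 <= (c j * cabs ((m - j%:Z == n)%:R - (m == n)%:R : R[i]) ^+ 2)%:E)%E.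
  by rewrite lee_fin mulr_ge0 ?coef_ge0 ?sqr_ge0.
apply: (@lt_le_trans _ _ (c k * cabs ((n - k%:Z == n)%:R - (n == n)%:R : R[i]) ^+ 2)%:E).
  rewrite eqxx -[X in _ == X]subr0 (inj_eq (addrI n)) eqr_opp.
  have -> : (k%:Z == 0) = false by case: k k1 {ck F0}.
  by rewrite sub0r cabs_sqN (cabs_sqC 1) expr1n mulr1 lte_fin.
pose G j m := (c j * cabs ((m - j%:Z == n)%:R - (m == n)%:R : R[i]) ^+ 2)%:E.
apply: (@le_trans _ _ (\esum_(m in [set: int]) G k m)).
  exact: (@esum_ge1 _ _ (G k) n (F0 k n)).
apply: (@esum_ge1 _ _ (fun k => \esum_(m in [set: int]) G k m) k).
by apply: esum_ge0 => m _; exact: F0.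
Qed.

Lemma Mult_iff lam : Mult w lam <-> linfty lam /\
  exists C : R, forall f, trigpoly f ->
    (\esum_(k in [set: int]) ((cabs (fourier f k) ^+ 2)%:E * musq c lam k)
      <= (C ^+ 2)%:E * normsq w f)%E.
Proof.
split=> [/bound_of_mult[K K0 bd]|[[M lamM] [C bd]]].
  have lamK n : cabs (lam n) ^+ 2 <= K.
    have := bd [:: n] (fun m => (m == n)%:R); rewrite -cexp_tp.
    have -> : tp [:: n] (fun m => lam m * (m == n)%:R) = (fun t => lam n * cexp n t).
      by apply/funext => t; rewrite /tp big_seq1 eqxx mulr1.
    rewrite nrmZ ?ler_pM2r ?nrm_cexp_gt0//.
    by rewrite cexp_tp; exact: L2_tp.
  split.
    exists (Num.sqrt K) => n; rewrite -(@ler_pXn2r _ 2)// ?nnegrE ?cabs_ge0 ?sqrtr_ge0//.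
    by rewrite sqr_sqrtr.
  (* 4 K comes from the energy of lam a, and 4 K from the bound K on |lam|^2. *)
  exists (Num.sqrt (8 * K)) => _ /trigpolyP[s [a [sa ->]]].
  rewrite sqr_sqrtr ?mulr_ge0// normsq_tp//.
  under eq_esum => k _ do rewrite (fourier_tp k sa).
  apply: le_trans (musq_sum_le a lamK) _.
  rewrite (energy_nrm (supported_mul lam sa)) (energy_nrm sa) -!EFinM -EFinD lee_fin.
  by have := bd s a; lra.
have M0 : 0 <= M by exact: le_trans (cabs_ge0 _) (lamM 0).
have lamM2 n : cabs (lam n) ^+ 2 <= M ^+ 2.
  by rewrite ler_pXn2r// nnegrE cabs_ge0.
apply: (@mult_of_bound _ (2 * M ^+ 2 + 2 * C ^+ 2)).
  by rewrite addr_ge0// mulr_ge0// sqr_ge0.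
move=> s a sa; have := energy_mul_le a lamM2.
have := bd (tp s a) ((trigpolyP _).2 (ex_intro _ s (ex_intro _ a (conj sa erefl)))).
under eq_esum => k _ do rewrite (fourier_tp k sa).
rewrite normsq_tp// (energy_nrm (supported_mul lam sa)) (energy_nrm sa).
set S := esum _ _ => SC.
have : (2%:E * S <= 2%:E * ((C ^+ 2)%:E * (nw (tp s a))%:E))%E by exact: lee_wpmul2l.
move=> /(leeD2l ((2 * M ^+ 2)%:E * (nw (tp s a))%:E)%E) h /le_trans/(_ h).
by rewrite -!EFinM -EFinD lee_fin; lra.
Qed.

(** Every mu_k is 0, because c_|k-j| > 0 forces j into k + d Z, where lam has the value lam k. The
    criterion then holds with C = 0. *)
Lemma coset_constant_mult (d : nat) lam : (forall k, 0 < c k -> (d %| k)%N) ->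
  linfty lam -> (forall (n q : int), lam (n + d%:Z * q) = lam n) -> Mult w lam.
Proof.
move=> dc lamb per; apply/Mult_iff; split=> //; exists 0 => f _.
rewrite expr0n mul0e esum1// => k _.
suff -> : musq c lam k = 0%E by rewrite mule0.
apply: esum1 => j _; have := coef_ge0 `|k - j|; rewrite le_eqVlt => /predU1P[<-|].
  by rewrite mul0r.
move=> /dc dk; have /dvdzP[q kj] : (d%:Z %| k - j)%Z by rewrite dvdzE.
have -> : j = k + d%:Z * - q.
  by rewrite mulrN (mulrC _ q) -kj subKr.
by rewrite per subrr cabs0 expr0n mulr0.
Qed.

End LKS.

(** * Integrability of the inverse weight *)

(** Subtracting the largest multiple of pi below x leaves a zero in [0, pi), where the sine is
    positive except at 0. *)
Lemma sin_eq0_nat (R : realType) (x : R) : 0 <= x -> sin x = 0 -> exists n : nat, x = n%:R * pi.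
Proof.
move=> x0 sx; have pi0 := @pi_gt0 R; pose n := Num.trunc (x / pi); exists n.
have xp0 : 0 <= x / pi by rewrite divr_ge0// ltW.
have nx : n%:R * pi <= x by rewrite -ler_pdivlMr// truncn_le.
have xn : x < n%:R * pi + pi.
  by have := truncnS_gt (x / pi); rewrite ltr_pdivrMr// -/n -natr1 mulrDl mul1r.
have sinB (y : R) (j : nat) : sin (y + j%:R * pi) = (-1) ^+ j * sin y.
  elim: j => [|j IH]; first by rewrite mul0r addr0 mul1r.
  by rewrite -natr1 mulrDl mul1r addrA sinDpi IH exprS mulN1r mulNr.
pose y := x - n%:R * pi.
have sy : sin y = 0.
  apply/eqP; have := sinB y n; rewrite subrK sx => /esym/eqP.
  by rewrite mulf_eq0 signr_eq0.
have y0 : 0 <= y by rewrite subr_ge0.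
move: y0; rewrite le_eqVlt => /predU1P[/eqP|y0].
  by rewrite eq_sym subr_eq0 => /eqP.
have := @sin_gt0_pi R y; rewrite sy ltxx y0 ltrBlDl => /(_ xn).
done.
Qed.

Section Alternative.
Variables (R : realType) (c : nat -> R).
Implicit Types (s : seq int) (a lam : int -> R[i]) (f g : R -> R[i]).
Local Notation I := (@circle_dom R).
Local Notation mu := (@lebesgue_measure R).
Let mI := @measurable_circle_dom R.
#[local] Hint Resolve mI : core.

Hypothesis hc0 : c 0%N = 0.
Hypothesis hc : forall k : nat, (1 <= k)%N -> 0 <= c k.
Hypothesis hcsum : (0 < \sum_(1 <= k <oo) (c k)%:E < +oo)%E.

Local Notation w := (LKS_weight c).
Let w0 : forall t, 0 <= w t := LKS_weight_ge0 hc0 hc hcsum.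
Let mw : measurable_fun I w := measurable_LKS_weight hc0 hc hcsum.
Local Notation nw := (nrm w).
Let L2tp s a : L2 w (tp s a) := L2_tp hc0 hc hcsum s a.

(** A zero of w is a zero of sin(k t / 2) for any one k with c_k > 0, so it lies in a countable
    set. *)
Lemma LKS_weight_gt0_ae : {ae mu, forall t, I t -> 0 < w t}.
Proof.
have [k k1 ck] := exists_coef_gt0 hc0 hc hcsum.
have kR : 0 < k%:R :> R by rewrite ltr0n.
exists (range (fun n : nat => n%:R * pi * 2 / k%:R : R)); split.
- by apply: countable_measurable => [t|]; [exact: measurable_set1|exact: card_image_le].
- by apply: countable_lebesgue_measure0; exact: card_image_le.
move=> t /= /not_implyP[It /negP]; rewrite -leNgt => wt.
have : 4 * (c k * sin (k%:R * t / 2) ^+ 2) <= 0.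
  exact: le_trans (LKS_weight_ge_term hc0 hc hcsum k t) wt.
rewrite pmulr_rle0// pmulr_rle0// => s0.
have {}s0 : sin (k%:R * t / 2) = 0.
  by apply/eqP; rewrite -sqrf_eq0 eq_le s0 sqr_ge0.
have t0 : 0 <= t by move: It; rewrite /circle_dom /= in_itv /= => /andP[].
have [||n nE] := @sin_eq0_nat R (k%:R * t / 2) => //; first by rewrite !mulr_ge0// ltW.
exists n => //; rewrite -nE; field.
by rewrite gt_eqF.
Qed.

Lemma measurable_inv_LKS_weight : measurable_fun I (fun t => (w t)^-1).
Proof.
under eq_fun do rewrite -powR_inv1//.
exact: measurableT_comp (measurable_powR _) mw.
Qed.

Lemma inv_weight_ge0 t : 0 <= (w t)^-1.
Proof. by rewrite invr_ge0. Qed.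

(* Off the zeros of w, |f| <= (x |f|^2 w + 1 / (x w)) / 2 for every x > 0; integrate and
   optimize over x. *)
Lemma mean_cabs_le f : L2 w f -> L1 (fun t => (w t)^-1) ->
  L1 (fun t => cabs (f t)) /\
  fine (circle_int (fun t => cabs (f t))) ^+ 2 <=
    fine (circle_int (fun t => (w t)^-1)) * nw f.
Proof.
move=> Lf Lw; have [mf _] := (L2P _ _).1 Lf; have mi := measurable_inv_LKS_weight.
have mcabs : measurable_fun I (fun t => cabs (f t)).
  have -> : (fun t => cabs (f t)) = (fun t => Num.sqrt (cabs (f t) ^+ 2)).
    by apply/funext => t; rewrite sqrtr_sqr ger0_norm ?cabs_ge0.
  have ms := continuous_measurable_fun (@sqrt_continuous R).
  exact: measurableT_comp ms (measurable_cabs_sq mf).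
have [J JE] : exists J, circle_int (fun t => (w t)^-1) = J%:E.
  have /L1P h := Lw; exists (fine (circle_int (fun t => (w t)^-1))).
  rewrite fineK// ge0_fin_numE ?h//; first by move=> t _; exact: inv_weight_ge0.
  by apply: circle_int_ge0 => t _; exact: inv_weight_ge0.
have md := measurable_density mw mf.
have bd x : 0 < x ->
    (circle_int (fun t => cabs (f t)) <= (x / 2 * nw f + (2 * x)^-1 * J)%:E)%E.
  move=> x0; have x20 : 0 <= x / 2 by rewrite divr_ge0// ltW.
  have xi0 : 0 <= (2 * x)^-1 by rewrite invr_ge0 mulr_ge0// ltW.
  have d0 t : 0 <= cabs (f t) ^+ 2 * w t by rewrite mulr_ge0 ?sqr_ge0.
  have i0 t : 0 <= (2 * x)^-1 * (w t)^-1 by rewrite mulr_ge0// inv_weight_ge0.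
  have e1 := circle_intZl md (fun t _ => d0 t) x20.
  have e2 := circle_intZl mi (fun t _ => inv_weight_ge0 t) xi0.
  rewrite EFinD !EFinM -JE -(nrmE w0 Lf) /normsq -EFinM -e1 -e2 -circle_intD//; last 3 first.
  - by apply: measurable_funM.
  - by apply: measurable_funM.
  - by move=> t _; rewrite mulr_ge0.
  apply: ae_le_circle_int => //.
  - by apply: measurable_funD; apply: measurable_funM.
  - by move=> t _; exact: cabs_ge0.
  - by move=> t _; rewrite addr_ge0// mulr_ge0 ?inv_weight_ge0// mulr_ge0 ?sqr_ge0.
  have [N [mN N0 subN]] := LKS_weight_gt0_ae; exists N; split=> // t /= nt.
  apply: subN => /= wpos; apply: nt => It; have wt := wpos It.
  have wn : w t != 0 by rewrite gt_eqF.
  have xn : x != 0 by rewrite gt_eqF.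
  move: (cabs (f t)) => y.
  have -> : x / 2 * (y ^+ 2 * w t) + (2 * x)^-1 * (w t)^-1 =
      y + (x * y * w t - 1) ^+ 2 / (2 * (x * w t)) by field; rewrite wn xn.
  by rewrite lerDl divr_ge0 ?sqr_ge0// mulr_ge0// mulr_ge0// ltW.
have L1f : L1 (fun t => cabs (f t)).
  apply/L1P => //; first by move=> t _; exact: cabs_ge0.
  exact: le_lt_trans (bd 1 ltr01) (ltry _).
have ci0 : (0 <= circle_int (fun t => cabs (f t)))%E.
  by apply: circle_int_ge0 => t _; exact: cabs_ge0.
have [m mE] : exists m, circle_int (fun t => cabs (f t)) = m%:E.
  exists (fine (circle_int (fun t => cabs (f t)))).
  by rewrite fineK// ge0_fin_numE//; apply: le_lt_trans (bd 1 ltr01) (ltry _).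
have m0 : 0 <= m by rewrite -lee_fin -mE.
have J0 : 0 <= J.
  by rewrite -lee_fin -JE; apply: circle_int_ge0 => t _; exact: inv_weight_ge0.
(* The optimization over x is the discriminant of x^2 nrm f - 2 x m + J; for x <= 0 every term is
   already nonnegative. *)
split=> //; rewrite mE JE /= -sqrrN; apply: discriminant_le; first exact: nrm_ge0.
move=> x; have [x0|x0] := ltP 0 x; last first.
  have : 0 <= - x * m by rewrite mulr_ge0// oppr_ge0.
  have := mulr_ge0 (sqr_ge0 x) (nrm_ge0 w0 f); lra.
have := bd x x0; rewrite mE lee_fin => mle.
have : 2 * x * m <= 2 * x * (x / 2 * nw f + (2 * x)^-1 * J).
  by rewrite ler_wpM2l// mulr_ge0// ltW.
have -> : 2 * x * (x / 2 * nw f + (2 * x)^-1 * J) = x ^+ 2 * nw f + J.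
  by field; rewrite gt_eqF.
lra.
Qed.

(** Real and imaginary parts of the coefficient are each bounded by the mean of |f|, hence the
    factor 2. *)
Lemma coef_sq_le : L1 (fun t => (w t)^-1) -> exists2 K, 0 <= K &
  forall s a n, supported s a -> cabs (a n) ^+ 2 <= K * nw (tp s a).
Proof.
move=> Lw; exists (2 * fine (circle_int (fun t => (w t)^-1))).
  rewrite mulr_ge0// fine_ge0//; apply: circle_int_ge0 => t _; exact: inv_weight_ge0.
move=> s a n sa; have [L1f le2] := mean_cabs_le (L2tp s a) Lw.
have [i1 i2] : cintegrable (fun t => tp s a t * cexp (- n) t).
  by rewrite tp_mul_cexp; exact: cintegrable_tp.
have bd (P : R[i] -> R) : (forall z, P z ^+ 2 <= cabs z ^+ 2) ->
    L1 (fun t => P (tp s a t * cexp (- n) t)) ->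
    ((2 * pi)^-1 * Rintegral mu I (fun t => P (tp s a t * cexp (- n) t))) ^+ 2 <=
    fine (circle_int (fun t => cabs (tp s a t))) ^+ 2.
  move=> Pc iP; rewrite fine_circle_int -real_normK ?num_real//.
  have pi0 : 0 <= (2 * pi)^-1 :> R by rewrite invr_ge0 ltW// twopi_gt0.
  rewrite ler_pXn2r ?nnegrE//; last first.
    by rewrite mulr_ge0// Rintegral_ge0// => t _; exact: cabs_ge0.
  rewrite normrM ger0_norm// ler_wpM2l//.
  apply: le_trans (@le_normr_Rintegral _ _ _ mu I _ mI iP) _.
  apply: le_Rintegral => //; first exact: (@integrable_norm _ _ _ mu I).
  move=> t _; rewrite -(@ler_pXn2r _ 2)// ?nnegrE ?cabs_ge0// real_normK ?num_real//.
  by apply: le_trans (Pc _) _; rewrite cabs_sqM cabs_sq_cexp mulr1.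
rewrite -(fourier_tp n sa) fourier_cmean /cmean cabs_sqM cabs_sqC cabs_sq /=.
have h1 := bd (@complex.Re R) (@Re_sq_le R) i1.
have h2 := bd (@complex.Im R) (@Im_sq_le R) i2.
move: h1 h2 le2; rewrite !exprMn -mulrA; lra.
Qed.

(** The image of a polynomial is a fixed finite sum of lam_n a_n e_n, and each |a_n|^2 is controlled
    by the norm. The sum is taken over the support of lam, so the constant is independent of the
    polynomial. *)
Lemma finsupp_mult : L1 (fun t => (w t)^-1) -> @finsupp_seq R `<=` Mult w.
Proof.
move=> Lw lam /finite_seqP[r rE]; have [K K0 coefK] := coef_sq_le Lw.
pose r' := undup r.
have lam0 n : n \notin r' -> lam n = 0.
  rewrite mem_undup => nr; apply/eqP/negPn/negP => ln.
  have : [set` r] n by rewrite -rE.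
  by move=> /=; rewrite (negbTE nr).
have [S S0 bdS] : exists2 S, 0 <= S & forall s a, supported s a ->
    nw (tp r' (fun n => lam n * a n)) <= S * nw (tp s a).
  elim: r' {lam0 rE} => [|n q [S S0 IH]].
    exists 0 => // s a _; have -> : tp [::] (fun n => lam n * a n) = fun=> 0.
      by apply/funext => t; rewrite /tp big_nil.
    by rewrite nrm0 mul0r.
  have e0 := nrm_ge0 w0 (@cexp R n).
  exists (2 * (cabs (lam n) ^+ 2 * K * nw (@cexp R n) + S)) => [|s a sa].
    by rewrite mulr_ge0// addr_ge0// mulr_ge0// mulr_ge0// sqr_ge0.
  have -> : tp (n :: q) (fun n => lam n * a n) =
      (fun t => lam n * a n * cexp n t + tp q (fun n => lam n * a n) t).
    by apply/funext => t; rewrite /tp big_cons.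
  have Le : L2 w (@cexp R n) by rewrite cexp_tp.
  apply: le_trans (nrmD w0 mw (L2Z w0 mw (lam n * a n) Le) (L2tp _ _)) _.
  rewrite nrmZ// cabs_sqM.
  have : nw (@cexp R n) * cabs (lam n) ^+ 2 * cabs (a n) ^+ 2 <=
      nw (@cexp R n) * cabs (lam n) ^+ 2 * (K * nw (tp s a)).
    by apply: ler_wpM2l; [rewrite mulr_ge0 ?sqr_ge0|exact: coefK].
  by have := IH s a sa; lra.
apply: (@mult_of_bound _ _ hc0 hc hcsum _ S) => // s a sa.
have -> : tp s (fun n => lam n * a n) = tp r' (fun n => lam n * a n).
  have [u [uu us ur]] := common_support s r'.
  have [-> _] := tp_widen (supported_mul lam sa) uu us.
  have sr : supported r' (fun n => lam n * a n).
    by split=> [|n /lam0 ->]; [exact: undup_uniq|rewrite mul0r].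
  by have [-> _] := tp_widen sr uu ur.
exact: bdS.
Qed.

(** * The algebra of trigonometric polynomials *)

Lemma trigpoly_lin (z : R[i]) f g : trigpoly f -> trigpoly g ->
  trigpoly (fun t => z * f t + g t).
Proof.
move=> /trigpolyP[s [a [sa ->]]] /trigpolyP[s' [a' [sa' ->]]]; apply/trigpolyP.
have [u [uu us us']] := common_support s s'.
have [e ua] := tp_widen sa uu us; have [e' ua'] := tp_widen sa' uu us'.
exists u, (fun n => z * a n + a' n); split; first exact: supported_lin.
by apply/funext => t; rewrite e e' tp_lin.
Qed.

Lemma trigpoly_cexp n : trigpoly (@cexp R n).
Proof. by rewrite cexp_tp; exists [:: n], (fun m => (m == n)%:R). Qed.

Lemma trigpoly_cst (z : R[i]) : trigpoly (fun=> z).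
Proof.
have := trigpoly_lin (z - 1) (trigpoly_cexp 0) (trigpoly_cexp 0).
by congr trigpoly; apply/funext => t; rewrite cexp0; ring.
Qed.

Lemma trigpoly_mul f g : trigpoly f -> trigpoly g -> trigpoly (fun t => f t * g t).
Proof.
move=> [s [a fE]] [s' [a' gE]].
have -> : (fun t => f t * g t) = (fun t => \sum_(n <- s) a n * (tp s' a' t * cexp n t)).
  apply/funext => t; rewrite fE gE mulr_suml; apply: eq_bigr => n _.
  by rewrite -mulrA; congr (_ * _); rewrite mulrC.
elim: s {fE} => [|n s IH].
  by have := trigpoly_cst 0; congr trigpoly; apply/funext => t; rewrite big_nil.
have tn : trigpoly (fun t => tp s' a' t * cexp n t).
  by rewrite tp_mul_cexp; eexists; eexists.
have := trigpoly_lin (a n) tn IH.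
by congr trigpoly; apply/funext => t; rewrite big_cons.
Qed.

Definition real_trigpoly (h : R -> R) := trigpoly (fun t => (h t)%:C%C).

Lemma real_trigpolyD h1 h2 : real_trigpoly h1 -> real_trigpoly h2 ->
  real_trigpoly (fun t => h1 t + h2 t).
Proof.
move=> t1 t2; have := trigpoly_lin 1 t1 t2.
by congr trigpoly; apply/funext => t; rewrite mul1r rmorphD.
Qed.

Lemma real_trigpolyM h1 h2 : real_trigpoly h1 -> real_trigpoly h2 ->
  real_trigpoly (fun t => h1 t * h2 t).
Proof.
move=> t1 t2; have := trigpoly_mul t1 t2.
by congr trigpoly; apply/funext => t; rewrite rmorphM.
Qed.

Lemma real_trigpoly_cst x : real_trigpoly (fun=> x).
Proof. exact: trigpoly_cst. Qed.

Lemma real_trigpoly_sum (J : Type) (r : seq J) (h : J -> R -> R) :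
  (forall j, real_trigpoly (h j)) -> real_trigpoly (fun t => \sum_(j <- r) h j t).
Proof.
move=> th; elim: r => [|j r IH].
  by have := real_trigpoly_cst 0; congr real_trigpoly; apply/funext => t; rewrite big_nil.
have := real_trigpolyD (th j) IH.
by congr real_trigpoly; apply/funext => t; rewrite big_cons.
Qed.

Lemma real_trigpolyX h n : real_trigpoly h -> real_trigpoly (fun t => h t ^+ n).
Proof.
move=> th; elim: n => [|n IH].
  by have := real_trigpoly_cst 1; congr real_trigpoly; apply/funext => t; rewrite expr0.
have := real_trigpolyM th IH.
by congr real_trigpoly; apply/funext => t; rewrite exprS.
Qed.

Lemma real_trigpoly_measurable h : real_trigpoly h -> measurable_fun I h.
Proof. by move=> /trigpolyP[s [a [_ e]]]; have := @cmeasurable_tp R s a; rewrite -e => -[]. Qed.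

Lemma real_trigpoly_L1 h : real_trigpoly h -> L1 h.
Proof. by move=> /trigpolyP[s [a [_ e]]]; have := @cintegrable_tp R s a; rewrite -e => -[]. Qed.

(** |e_k - 1|^2 is the product of e_k - 1 and its conjugate e_(-k) - 1. *)
Lemma real_trigpoly_chord (k : int) : real_trigpoly (fun t => cabs (cexp k t - 1) ^+ 2).
Proof.
have h n : trigpoly (fun t => @cexp R n t - 1).
  have := trigpoly_lin 1 (trigpoly_cexp n) (trigpoly_cst (-1)).
  by congr trigpoly; apply/funext => t; rewrite mul1r.
have := trigpoly_mul (h k) (h (- k)); congr trigpoly; apply/funext => t.
rewrite -conj_cexp cabs_sq; case: (cexp k t) => x y.
by apply/eqP; rewrite eq_complex /=; apply/andP; split; apply/eqP; ring.
Qed.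

(** A trigonometric polynomial below w, used because w itself may have infinitely many
    frequencies. *)
Definition truncated_weight (N : nat) (t : R) : R :=
  \sum_(0 <= k < N) c k * cabs (cexp k%:Z t - 1) ^+ 2.

Lemma weight_series t :
  ((w t)%:E = \sum_(0 <= k <oo) (c k * cabs (cexp k%:Z t - 1) ^+ 2)%:E)%E.
Proof.
by rewrite LKS_weight_series//; apply: eq_eseriesr => k _; rewrite termE.
Qed.

Let cge0 k : 0 <= c k := coef_ge0 hc0 hc k.

Lemma truncated_weight_ge0 N t : 0 <= truncated_weight N t.
Proof. by apply: sumr_ge0 => k _; rewrite mulr_ge0 ?sqr_ge0. Qed.

Lemma truncated_weight_le N t : truncated_weight N t <= w t.
Proof.
rewrite -lee_fin weight_series /truncated_weight -sumEFin.
by apply: nneseries_lim_ge => k _ _; rewrite lee_fin mulr_ge0 ?sqr_ge0.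
Qed.

(** The approximation is uniform in t: the remainder is at most a tail of 4 sum c_k. *)
Lemma le_truncated_weight d : 0 < d -> exists N, forall t, w t <= truncated_weight N t + d.
Proof.
move=> d0; pose tail N := (\sum_(N <= k <oo) (4 * c k)%:E)%E.
have c40 k : (0 <= (4 * c k)%:E)%E by rewrite lee_fin mulr_ge0.
have tail0 : tail N @[N --> \oo] --> 0%E.
  apply: nneseries_tail_cvg => //.
  under eq_eseriesr do rewrite EFinM.
  rewrite nneseriesZl//; last by move=> k _; rewrite lee_fin.
  by rewrite (coef_sumE hc0 hc hcsum) -EFinM ltry.
have [N tN] : exists N, (tail N <= d%:E)%E.
  apply: contrapT => nN.
  have : (d%:E <= limn tail)%E.
    apply: lime_ge; first by apply/cvg_ex; exists 0%E.
    apply: nearW => N; rewrite leNgt; apply/negP => /ltW tN.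
    by apply: nN; exists N.
  by rewrite (cvg_lim _ tail0)// lee_fin leNgt d0.
exists N => t; have t0 k : (0 <= (c k * cabs (cexp k%:Z t - 1) ^+ 2)%:E)%E.
  by rewrite lee_fin mulr_ge0 ?sqr_ge0.
rewrite -lee_fin weight_series (@nneseries_split _ _ 0 N)// add0n EFinD.
rewrite /truncated_weight -sumEFin leeD2l//; apply: le_trans tN.
apply: lee_nneseries => k _ //; rewrite lee_fin -termE.
by rewrite ler_wpM2l//; exact: (term_le hc0 hc).
Qed.

(** * From a bounded Fourier coefficient to the integrability of 1/w *)

Local Notation W := (4 * coef_sum c).

Let W_gt0 : 0 < W.
Proof. by rewrite mulr_gt0// coef_sum_gt0. Qed.

(** In the criterion only the k-th term is kept, and in mu_k^2 only the j-th, which is positive. *)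
Lemma mult_fourier_bound lam (j k : int) : Mult w lam -> 0 < c `|k - j|%N ->
  lam j <> lam k -> exists2 B, 0 <= B &
  forall f, trigpoly f -> cabs (fourier f k) ^+ 2 <= B * nw f.
Proof.
move=> /(Mult_iff hc0 hc hcsum)[_ [C bd]] ckj ljk.
pose r := c `|k - j|%N * cabs (lam j - lam k) ^+ 2.
have r0 : 0 < r.
  rewrite mulr_gt0// lt_neqAle sqr_ge0 andbT eq_sym; apply/eqP => /cabs_sq_eq0 e.
  by apply: ljk; apply/eqP; rewrite -subr_eq0 e.
exists (C ^+ 2 / r) => [|f tf]; first by rewrite divr_ge0 ?sqr_ge0// ltW.
have /trigpolyP[s [a [_ fE]]] := tf.
have Lf : L2 w f by rewrite fE.
have F0 i : (0 <= (cabs (fourier f i) ^+ 2)%:E * musq c lam i)%E.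
  by rewrite mule_ge0 ?lee_fin ?sqr_ge0// musq_ge0.
have := le_trans (@esum_ge1 _ _ (fun i => (cabs (fourier f i) ^+ 2)%:E * musq c lam i)%E k (F0 k))
  (bd f tf).
have rm : (r%:E <= musq c lam k)%E.
  apply: (@esum_ge1 _ _ (fun j => (c `|k - j|%N * cabs (lam j - lam k) ^+ 2)%:E) j).
  by rewrite lee_fin ltW.
rewrite (nrmE w0 Lf) => h.
have {h} : ((cabs (fourier f k) ^+ 2)%:E * r%:E <= (C ^+ 2)%:E * (nw f)%:E)%E.
  by apply: le_trans h; rewrite lee_wpmul2l// lee_fin sqr_ge0.
by rewrite -!EFinM lee_fin => h; rewrite mulrAC ler_pdivlMr.
Qed.

(** For f = h e_k the k-th coefficient is the mean of h, while |e_k| = 1 leaves the norm unchanged;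
    the index k disappears. *)
Lemma real_mean_bound B (k : int) :
  (forall f, trigpoly f -> cabs (fourier f k) ^+ 2 <= B * nw f) -> 0 <= B ->
  forall h, real_trigpoly h ->
  fine (circle_int h) ^+ 2 <= B * fine (circle_int (fun t => h t ^+ 2 * w t)).
Proof.
move=> bd B0 h th.
have := bd _ (trigpoly_mul th (trigpoly_cexp k)).
have -> : nw (fun t => (h t)%:C%C * cexp k t) = fine (circle_int (fun t => h t ^+ 2 * w t)).
  by congr fine; apply: eq_circle_int => t _; rewrite cabs_sqM cabs_sqC cabs_sq_cexp mulr1.
apply: le_trans; rewrite fourier_cmean.
have -> : (fun t => (h t)%:C%C * cexp k t * cexp (- k) t) = (fun t => (h t)%:C%C).
  by apply/funext => t; rewrite -mulrA -cexpD subrr cexp0 mulr1.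
apply: le_trans (Re_sq_le _).
by rewrite fine_circle_int /cmean ReM /= mul0r subr0.
Qed.

Let x (t : R) := 1 - w t / W.
Let xN N (t : R) := 1 - truncated_weight N t / W.

Let x_ge0 t : 0 <= x t.
Proof. by rewrite subr_ge0 ler_pdivrMr// mul1r LKS_weight_le. Qed.

Let xxN N t : x t <= xN N t <= 1.
Proof.
apply/andP; split; last by rewrite gerBl divr_ge0 ?truncated_weight_ge0// ltW.
by rewrite lerD2l lerN2 ler_wpM2r ?truncated_weight_le// invr_ge0 ltW.
Qed.

(* With g = sum_(n < M) x_N^n one has (1 - x_N) g <= 1, so that g^2 w is at most W g,
   up to the truncation error; the bound mean(g)^2 <= B mean(g^2 w) then bounds mean(g). *)
Lemma geometric_mean_bound B (k : int) :
  (forall f, trigpoly f -> cabs (fourier f k) ^+ 2 <= B * nw f) -> 0 <= B ->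
  forall M, (circle_int (fun t => \sum_(0 <= n < M) x t ^+ n)%R <= (B * W + B + 1)%:E)%E.
Proof.
(* Since g <= M, a truncation error d in the weight adds at most M^2 / (M^2 + 1) <= 1 to g^2 w. *)
move=> bd B0 M; pose d : R := (M%:R ^+ 2 + 1)^-1.
have M10 : 0 < M%:R ^+ 2 + 1 :> R by rewrite ltr_wpDl ?sqr_ge0.
have d0 : 0 < d by rewrite invr_gt0.
have [N wN] := le_truncated_weight d0.
pose h t := \sum_(0 <= n < M) xN N t ^+ n.
have xN0 t : 0 <= xN N t by case/andP: (xxN N t) => h1 _; exact: le_trans (x_ge0 t) h1.
have th : real_trigpoly h.
  apply: real_trigpoly_sum => n; apply: real_trigpolyX.
  have := real_trigpoly_sum (index_iota 0 N)
    (fun k => real_trigpolyM (real_trigpoly_cst (- c k / W)) (real_trigpoly_chord k%:Z)).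
  move=> /(real_trigpolyD (real_trigpoly_cst 1)).
  congr real_trigpoly; apply/funext => t; rewrite /xN /truncated_weight mulr_suml -sumrN.
  by congr (_ + _); apply: eq_bigr => i _; ring.
have h0 t : 0 <= h t by apply: sumr_ge0 => n _; exact: exprn_ge0.
have hM t : h t <= M%:R.
  have -> : M%:R = \sum_(0 <= n < M) (1 : R) by rewrite sumr_const_nat subn0.
  apply: ler_sum => n _; apply: exprn_ile1 => //.
  by case/andP: (xxN N t).
have hgeo t : (1 - xN N t) * h t <= 1.
  have : (1 - xN N t) * h t = 1 - xN N t ^+ M.
    by rewrite /h big_mkord -opprB mulNr -subrX1 opprB.
  by move=> ->; rewrite lerBlDr lerDl exprn_ge0.
have mh := real_trigpoly_measurable th.
have hint : (circle_int h < +oo)%E by apply/L1P => //; exact: real_trigpoly_L1.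
have ch0 : (0 <= circle_int h)%E by exact: circle_int_ge0.
pose m := fine (circle_int h).
have mE : circle_int h = m%:E by rewrite fineK// ge0_fin_numE.
have m0 : 0 <= m by rewrite fine_ge0.
have := real_mean_bound bd B0 th; rewrite -/m => m2.
have le1 : (circle_int (fun t => h t ^+ 2 * w t)%R <= (W * m + 1)%:E)%E.
  have mhw : measurable_fun I (fun t => h t ^+ 2 * w t).
    by apply: measurable_funM => //; exact: measurable_funX.
  rewrite EFinD EFinM -mE -circle_intZl//; last exact: ltW.
  rewrite -(circle_int_cst (1 : R)) -circle_intD//; last 2 first.
  - exact: measurable_funM.
  - by move=> t _; rewrite mulr_ge0// ltW.
  apply: le_circle_int => //.
    by apply: measurable_funD => //; exact: measurable_funM.
  move=> t _; rewrite mulr_ge0 ?sqr_ge0//=.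
  apply: (@le_trans _ _ (h t ^+ 2 * (truncated_weight N t + d))).
    by rewrite ler_wpM2l ?sqr_ge0.
  rewrite mulrDr; apply: lerD.
    have -> : truncated_weight N t = W * (1 - xN N t).
      by rewrite /xN subKr mulrC divfK// gt_eqF.
    rewrite mulrCA ler_wpM2l ?(ltW W_gt0)// expr2 -mulrA ler_piMr//.
    by rewrite mulrC.
  rewrite ler_pdivrMr// mul1r; apply: (@le_trans _ _ (M%:R ^+ 2)).
    by rewrite ler_pXn2r// nnegrE.
  by rewrite lerDl.
have fle : fine (circle_int (fun t => h t ^+ 2 * w t)) <= W * m + 1.
  rewrite -lee_fin fineK// ge0_fin_numE; first exact: le_lt_trans le1 (ltry _).
  by apply: circle_int_ge0 => t _; rewrite mulr_ge0 ?sqr_ge0.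
apply: (@le_trans _ _ (circle_int h)).
  apply: le_circle_int => //.
    apply: measurable_sum => n; apply: measurable_funX; apply: measurable_funB => //.
    exact: measurable_funM.
  move=> t _; rewrite sumr_ge0 => [|n _]; last exact: exprn_ge0.
  apply: ler_sum => n _; apply: lerXn2r; rewrite ?nnegrE//.
  by case/andP: (xxN N t).
rewrite mE lee_fin; have mle := le_trans m2 (ler_wpM2l B0 fle).
(* From m^2 <= B (W m + 1): if m exceeded B W + B + 1 then m >= 1, so m^2 <= (B W + B) m < m^2. *)
rewrite leNgt; apply/negP => big.
have BW : 0 <= B * W by rewrite mulr_ge0// ltW.
have : m * (B * W + B + 1) <= m * m by rewrite ler_wpM2l// ltW.
have : 1 <= m by lra.
move=> m1; have := ler_wpM2l B0 m1.
rewrite -expr2; lra.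
Qed.

(** The bound on the geometric sums does not depend on the number of terms, so it passes to the full
    series, which dominates W/w. *)
Lemma inv_weight_integrable B (k : int) :
  (forall f, trigpoly f -> cabs (fourier f k) ^+ 2 <= B * nw f) -> 0 <= B ->
  L1 (fun t => (w t)^-1).
Proof.
move=> bd B0; have gb := geometric_mean_bound bd B0; set Q := B * W + B + 1 in gb.
have mx n : measurable_fun I (fun t => x t ^+ n).
  apply: measurable_funX; apply: measurable_funB => //; exact: measurable_funM.
have xn0 n t : 0 <= x t ^+ n by exact: exprn_ge0.
have le_geo t : ((W * (w t)^-1)%:E <= \sum_(0 <= n <oo) (x t ^+ n)%:E)%E.
  (* At a zero of w the series diverges, but the inverse is 0 by convention, so the inequality
     survives. *)
  have [wt|wt] := eqVneq (w t) 0.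
    rewrite wt invr0 mulr0; apply: nneseries_ge0 => n _ _.
    by rewrite lee_fin.
  have wpos : 0 < w t by rewrite lt_neqAle eq_sym wt w0.
  have x1 : `|x t| < 1 by rewrite ger0_norm// ltrBlDr ltrDl divr_gt0.
  have := @cvg_geometric_series R 1 (x t) x1.
  have -> : 1 * (1 - x t)^-1 = W * (w t)^-1.
    by rewrite /x subKr mul1r invf_div.
  move=> cv; suff -> : (\sum_(0 <= n <oo) (x t ^+ n)%:E)%E = (W * (w t)^-1)%:E by [].
  apply: cvg_lim => //; apply/fine_cvgP; split.
    by apply: nearW => n; rewrite sumEFin.
  move: cv; apply: cvg_trans; apply: near_eq_cvg; apply: nearW => n /=.
  by rewrite sumEFin /= /series /=; apply: eq_bigr => i _; rewrite mul1r.
have LW : L1 (fun t => W * (w t)^-1).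
  have mi := measurable_inv_LKS_weight.
  apply/L1P; first exact: measurable_funM.
    by move=> t _; rewrite mulr_ge0 ?inv_weight_ge0// ltW.
  apply: (@le_lt_trans _ _ Q%:E); last exact: ltry.
  rewrite -(@lee_pmul2l _ (2 * pi)%:E) ?lte_fin ?twopi_gt0// -integral_circle_int.
  apply: (@le_trans _ _ (\int[mu]_(t in I) (\sum_(0 <= n <oo) (x t ^+ n)%:E))%E).
    apply: ge0_le_integral => //.
    - by move=> t _; rewrite lee_fin mulr_ge0 ?inv_weight_ge0// ltW.
    - by apply/measurable_EFinP; exact: measurable_funM.
    - apply: ge0_emeasurable_sum => [n t _ _|n _]; first by rewrite lee_fin.
      by apply/measurable_EFinP; exact: mx.
  rewrite integral_nneseries//; last 2 first.
  - by move=> n; apply/measurable_EFinP; exact: mx.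
  - by move=> n t _; rewrite lee_fin.
  apply: lime_le.
    apply: is_cvg_nneseries => n _ _; apply: integral_ge0 => t _.
    by rewrite lee_fin.
  apply: nearW => M; apply: le_trans (lee_wpmul2l _ (gb M)); last first.
    by rewrite lee_fin ltW// twopi_gt0.
  rewrite -integral_circle_int; under [leRHS]eq_integral do rewrite -sumEFin.
  rewrite ge0_integral_sum//.
    by move=> n; apply/measurable_EFinP; exact: mx.
  by move=> n t _; rewrite lee_fin.
have := L1_lin W^-1 0 LW LW.
by congr L1; apply/funext => t; rewrite mul0r addr0 mulrA mulVf ?mul1r// gt_eqF.
Qed.

Lemma divergent_mult_const lam : ~ L1 (fun t => (w t)^-1) -> Mult w lam ->
  forall j k : int, 0 < c `|k - j|%N -> lam j = lam k.
Proof.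
move=> nL ml j k ckj; apply: contrapT => ljk.
by have [B B0 bd] := mult_fourier_bound ml ckj ljk; exact: nL (inv_weight_integrable bd B0).
Qed.

End Alternative.

(** * Cosets *)

Section Periods.
Variables (T : Type) (lam : int -> T).

Lemma period_mul (d : nat) : (forall n, lam (n + d%:Z) = lam n) ->
  forall n (q : int), lam (n + d%:Z * q) = lam n.
Proof.
move=> P; have Pn (k : nat) n : lam (n + d%:Z * k%:Z) = lam n.
  elim: k => [|k IH]; first by rewrite mulr0 addr0.
  by rewrite -addn1 PoszD mulrDr mulr1 addrA P IH.
move=> n [k|k]; first exact: Pn.
by rewrite NegzE mulrN -(Pn k.+1 (n - _)) subrK.
Qed.

(** The least positive period e divides every k in A, as the remainder of k by e would otherwise be
    a smaller period. Hence e divides the gcd, which is thus a period too. *)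
Lemma gcd_period (A : set nat) : (exists2 k, A k & (0 < k)%N) ->
  (forall k, A k -> forall n, lam (n + k%:Z) = lam n) ->
  forall n, lam (n + (gcd_set A)%:Z) = lam n.
Proof.
move=> [k0 Ak0 k00] PA.
pose P d := `[< (0 < d)%N /\ forall n, lam (n + d%:Z) = lam n >].
have exP : exists d, P d by exists k0; apply/asboolP; split=> //; exact: PA.
case: (ex_minnP exP) => e /asboolP[e0 Pe] emin.
have edvd k : A k -> (e %| k)%N.
  move=> Ak; rewrite /dvdn; apply: contraT; rewrite -lt0n => r0.
  have : (e <= k %% e)%N.
    apply: emin; apply/asboolP; split=> // n.
    rewrite -(period_mul Pe _ (k %/ e)%N) -addrA -PoszM -PoszD addnC mulnC.
    by rewrite -divn_eq PA.
  by rewrite leqNgt ltn_mod e0.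
have [_ gmax] := gcd_setP A.
have /dvdnP[m ->] := gmax e edvd => n.
by rewrite mulnC PoszM period_mul.
Qed.

Lemma coset_constP (D : nat) : (0 < D)%N ->
  (forall k : nat, (k < D)%N -> forall m n : int,
     int_coset D k m -> int_coset D k n -> lam m = lam n) <->
  (forall n (q : int), lam (n + D%:Z * q) = lam n).
Proof.
move=> D0; split=> [h n q|h k kD m n [p ->] [q ->]]; last by rewrite !h.
have DZ : D%:Z != 0 by rewrite eqz_nat -lt0n.
have nE : n = `|(n %% D%:Z)%Z|%N%:Z + D%:Z * (n %/ D%:Z)%Z.
  by rewrite gez0_abs ?modz_ge0// mulrC addrC -divz_eq.
apply: (h `|(n %% D%:Z)%Z|%N).
- by rewrite -ltz_nat gez0_abs ?modz_ge0// ltz_pmod.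
- by exists ((n %/ D%:Z)%Z + q); rewrite mulrDr addrA -nE.
- by exists (n %/ D%:Z)%Z.
Qed.

End Periods.

Section CosetConstant.
Variables (R : realType) (D : nat).
Hypothesis D0 : (0 < D)%N.

Let periodic (lam : int -> R[i]) := forall n (q : int), lam (n + D%:Z * q) = lam n.

Let DZ : D%:Z != 0.
Proof. by rewrite eqz_nat -lt0n. Qed.

Lemma periodic_modz lam : periodic lam -> forall n, lam n = lam (n %% D%:Z)%Z.
Proof. by move=> h n; rewrite {1}(divz_eq n D%:Z) addrC mulrC h. Qed.

Lemma modz_ord (n : int) : exists i : 'I_D, (n %% D%:Z)%Z = (i : nat)%:Z.
Proof.
have nD : (`|(n %% D%:Z)%Z| < D)%N by rewrite -ltz_nat gez0_abs ?modz_ge0// ltz_pmod.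
by exists (Ordinal nD); rewrite /= gez0_abs ?modz_ge0.
Qed.

Lemma periodic_linfty lam : periodic lam -> linfty lam.
Proof.
move=> h; exists (\sum_(i < D) cabs (lam (i : nat)%:Z)) => n.
rewrite (periodic_modz h); have [i ->] := modz_ord n.
rewrite (bigD1 i)//= lerDl; apply: sumr_ge0 => j _; exact: cabs_ge0.
Qed.

(** The basis consists of the indicator sequences of the residue classes modulo D. *)
Lemma cdim_periodic : cdim [set lam : int -> R[i] | periodic lam] D.
Proof.
pose b (i : 'I_D) (n : int) : R[i] := ((n %% D%:Z)%Z == (i : nat)%:Z)%:R.
have sumb (a : 'I_D -> R[i]) (n : int) (i : 'I_D) : (n %% D%:Z)%Z = (i : nat)%:Z ->
    \sum_(j < D) a j * b j n = a i.
  move=> ni; rewrite (bigD1 i)//= /b ni eqxx mulr1 big1 ?addr0// => j ji.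
  by rewrite eqz_nat (inj_eq val_inj) eq_sym (negbTE ji) mulr0.
exists b; split=> [a az i|].
  rewrite -(sumb a (i : nat)%:Z i) ?az// modz_small//.
  by rewrite lez_nat ltz_nat /=.
apply/seteqP; split=> lam /=.
  move=> h; exists (fun i => lam (i : nat)%:Z) => k; have [i ki] := modz_ord k.
  by rewrite (sumb _ _ _ ki) (periodic_modz h) ki.
move=> [a lamE] n q; rewrite !lamE; apply: eq_bigr => i _.
by rewrite /b addrC (mulrC D%:Z) modzMDl.
Qed.

End CosetConstant.

Theorem theorem3p4 (R : realType) (c : nat -> R)
    (hc0 : c 0%N = 0)
    (hc : forall k : nat, (1 <= k)%N -> 0 <= c k)
    (hcsum : (0 < \sum_(1 <= k <oo) (c k)%:E < +oo)%E) :
  let w := LKS_weight c in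
  let D := gcd_set [set k : nat | (1 <= k)%N /\ 0 < c k] in
  (forall lam : int -> R[i],
     Mult w lam <->
     linfty lam /\
     exists C : R, forall f : R -> R[i], trigpoly f ->
       (\esum_(k in [set: int]) ((cabs (fourier f k) ^+ 2)%:E * musq c lam k)
        <= (C ^+ 2)%:E * normsq w f)%E) /\
  ((L1 (fun t => (w t)^-1) /\ (@finsupp_seq R `<=` Mult w)) \/
   (~ L1 (fun t => (w t)^-1) /\
    Mult w = [set lam : int -> R[i] |
                forall k : nat, (k < D)%N ->
                forall m n : int, int_coset D k m -> int_coset D k n ->
                  lam m = lam n] /\
    cdim (Mult w) D)).
Proof.
move=> w D; split; first exact: Mult_iff.
have [Lw|nLw] := pselect (L1 (fun t => (w t)^-1)); [left|right].
  by split=> //; exact: finsupp_mult.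
have [k1 k10 ck1] := exists_coef_gt0 hc0 hc hcsum.
have [Ddvd _] := gcd_setP [set k : nat | (1 <= k)%N /\ 0 < c k].
have D0 : (0 < D)%N by exact: dvdn_gt0 k10 (Ddvd k1 (conj k10 ck1)).
(* Periodicity is the working form of constancy on cosets; the two agree because D is positive. *)
have MultE : Mult w = [set lam | forall n (q : int), lam (n + D%:Z * q) = lam n].
  apply/seteqP; split=> lam /= h.
    apply: period_mul; apply: gcd_period; first by exists k1.
    move=> k [k0 ck] n; apply: (divergent_mult_const hc0 hc hcsum nLw h).
    by rewrite opprD addrA subrr add0r abszN.
  apply: (coset_constant_mult hc0 hc hcsum (d := D)) => //.
    move=> k ck; apply: Ddvd; split=> //.
    by case: k ck => //; rewrite hc0 ltxx.
  exact: (periodic_linfty D0).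
split=> //; rewrite MultE; split; last exact: (cdim_periodic R D0).
by apply/seteqP; split=> lam /=; [move/(coset_constP _ D0).2|move/(coset_constP _ D0).1].
Qed.
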